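(* Let $\mathbf{H}$ be the free symmetric strict monoidal category generated by a commutative Hopf monoid $\mathsf{H}$, let $\mathbf{F}$ be the symmetric strict monoidal category of finitely generated free groups $F_n$ ($n\ge 0$) with tensor product given by free product, and let $T\colon \mathbf{H}\to\mathbf{F}$ be the unique strict symmetric monoidal functor which maps the Hopf monoid $\mathsf{H}$ to the commutative Hopf monoid $\mathsf{F}=(1,\mu_{\mathsf F},\eta_{\mathsf F},\Delta_{\mathsf F},\epsilon_{\mathsf F},S_{\mathsf F})$ in $\mathbf{F}$. Then $T\colon\mathbf{H}\to\mathbf{F}$ is an isomorphism of symmetric strict monoidal categories.
   Context: In a symmetric strict monoidal category $\mathcal{C}=(\mathcal C,\otimes,I,P)$ with symmetry $P_{X,Y}\colon X\otimes Y\to Y\otimes X$, an object's name also denotes its identity morphism. A Hopf monoid in $\mathcal C$ is an object $H$ with morphisms $\mu\colon H\otimes H\to H$, $\eta\colon I\to H$, $\Delta\colon H\to H\otimes H$, $\epsilon\colon H\to I$, $S\colon H\to H$ satisfying: $\mu(\mu\otimes H)=\mu(H\otimes\mu)$, $\mu(\eta\otimes H)=1_H=\mu(H\otimes\eta)$; $(\Delta\otimes H)\Delta=(H\otimes\Delta)\Delta$, $(\epsilon\otimes H)\Delta=1_H=(H\otimes\epsilon)\Delta$; $\epsilon\eta=1_I$, $\epsilon\mu=\epsilon\otimes\epsilon$, $\Delta\eta=\eta\otimes\eta$; $\Delta\mu=(\mu\otimes\mu)(H\otimes P_{H,H}\otimes H)(\Delta\otimes\Delta)$; $\mu(H\otimes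 S)\Delta=\mu(S\otimes H)\Delta=\eta\epsilon$. It is commutative if $\mu P_{H,H}=\mu$. The category $\mathbf H$: it is the free symmetric strict monoidal category generated by a commutative Hopf monoid $\mathsf H$. Its objects are the tensor powers $\mathsf H^{\otimes n}$, $n\ge 0$, identified with the integers $n$. Its morphisms are obtained by tensor products and compositions from identities, symmetries and $\mu,\eta,\Delta,\epsilon,S$ of $\mathsf H$, subject only to the relations implied by the axioms of symmetric strict monoidal category and of commutative Hopf monoid. Equivalently, for any symmetric strict monoidal category $\mathcal C$ and any commutative Hopf monoid $A$ in $\mathcal C$ there is a unique strict symmetric monoidal functor $\mathbf H\to\mathcal C$ sending $\mathsf H$ to $A$ and the structure morphisms of $\mathsf H$ to those of $A$. The category $\mathbf F$: let $F_n=\langle x_1,\ldots,x_n\rangle$ be the free group of rank $n$. $\mathbf F$ is the full subcategory of the category of groups with objects $F_n$, $n\ge 0$, and $F_n$ is identified with $n$. For $w_1,\ldots,w_m\in F_n$, write $[w_1,\ldots,w_m]_{m,n}\colon F_m\to F_n$ for the homomorphism with $x_i\mapsto w_i$. The monoidal structure is $m\otimes n=m+n$ with unit $0=F_0$. For $f\colon m\to n$ and $f'\colon m'\to n'$, $f\otimes f'\colon F_{m+m'}\to F_{n+n'}$ is the homomorphism with $(f\otimes f')(x_i)=f(x_i)$ for $1\le i\le m$ and $(f\otimes f')(x_i)=s_n(f'(x_{i-m}))$ for $m+1\le i\le m+m'$, where $s_n\colon F_{n'}\to F_{n+n'}$ is $s_n(x_i)=x_{i+n}$. The symmetry is $P_{m,n}=[x_{n+1},\ldots,x_{n+m},x_1,\ldots,x_n]_{m+n,n+m}$.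 The commutative Hopf monoid $\mathsf F$ in $\mathbf F$ has underlying object $1$ and structure morphisms $\mu_{\mathsf F}=[x_1,x_1]_{2,1}$, $\eta_{\mathsf F}=[\;]_{0,1}$, $\Delta_{\mathsf F}=[x_1x_2]_{1,2}$, $\epsilon_{\mathsf F}=[1]_{1,0}$, $S_{\mathsf F}=[x_1^{-1}]_{1,1}$. *)

(* Defs.v *)
From HB Require Import structures.
From mathcomp Require Import all_boot.
From mathcomp Require Import boolp.

Set Implicit Arguments.
Unset Strict Implicit.
Unset Printing Implicit Defensive.

#[local] Obligation Tactic := idtac.

Declare Scope smc_scope.
Delimit Scope smc_scope with smc.
Local Open Scope smc_scope.

Reserved Notation "g ⊚ f" (at level 45, right associativity).
Reserved Notation "X ⊗ Y" (at level 40, left associativity).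
Reserved Notation "f ⊠ g" (at level 40, left associativity).
Reserved Notation "f ≡ g" (at level 70, no associativity).
Reserved Notation "s ≈ t" (at level 70, no associativity).

Record category := Category {
  ob :> Type;
  hom : ob -> ob -> Type;
  idm : forall X, hom X X;
  comp : forall X Y Z, hom Y Z -> hom X Y -> hom X Z;
  compA : forall X Y Z W (h : hom Z W) (g : hom Y Z) (f : hom X Y),
    comp h (comp g f) = comp (comp h g) f;
  comp1m : forall X Y (f : hom X Y), comp (idm Y) f = f;
  compm1 : forall X Y (f : hom X Y), comp f (idm X) = f
}.
Arguments hom {c}.
Arguments idm {c}.
Arguments comp {c X Y Z}.

Notation "g ⊚ f" := (comp g f) : smc_scope.

(* Strict monoidal axioms equate morphisms whose sources and targets are only
   propositionally equal. [f ≡ g] is equality of morphisms in the set of all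
   morphisms: equal source, equal target and, along these, equal morphisms. *)
Definition arrow (C : category) := {X : C & {Y : C & hom X Y}}.
Definition arr (C : category) (X Y : C) (f : hom X Y) : arrow C :=
  existT _ X (existT _ Y f).
Notation "f ≡ g" := (arr f = arr g) : smc_scope.

(* The identity of X = Y; it only serves to compose morphisms whose types match
   up to a strict equality of objects. *)
Definition eqid (C : category) (X Y : C) (e : X = Y) : hom X Y :=
  match e in _ = Z return hom X Z with erefl => idm X end.

Record ssmcat := SSMCat {
  ssm_cat :> category;
  tens : ssm_cat -> ssm_cat -> ssm_cat;
  unito : ssm_cat;
  tensm : forall X Y X' Y' : ssm_cat,
    hom X Y -> hom X' Y' -> hom (tens X X') (tens Y Y');
  symm : forall X Y : ssm_cat, hom (tens X Y) (tens Y X);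
  tens_id : forall X Y : ssm_cat, tensm (idm X) (idm Y) = idm (tens X Y);
  tens_comp : forall (X Y Z X' Y' Z' : ssm_cat)
      (g : hom Y Z) (f : hom X Y) (g' : hom Y' Z') (f' : hom X' Y'),
    tensm (g ⊚ f) (g' ⊚ f') = tensm g g' ⊚ tensm f f';
  tensoA : forall X Y Z : ssm_cat, tens (tens X Y) Z = tens X (tens Y Z);
  tens1o : forall X : ssm_cat, tens unito X = X;
  tenso1 : forall X : ssm_cat, tens X unito = X;
  tensmA : forall (X Y X' Y' X'' Y'' : ssm_cat)
      (f : hom X Y) (g : hom X' Y') (h : hom X'' Y''),
    tensm (tensm f g) h ≡ tensm f (tensm g h);
  tens1m : forall (X Y : ssm_cat) (f : hom X Y), tensm (idm unito) f ≡ f;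
  tensm1 : forall (X Y : ssm_cat) (f : hom X Y), tensm f (idm unito) ≡ f;
  symm_nat : forall (X Y X' Y' : ssm_cat) (f : hom X Y) (g : hom X' Y'),
    symm Y Y' ⊚ tensm f g = tensm g f ⊚ symm X X';
  symmK : forall X Y : ssm_cat, symm Y X ⊚ symm X Y = idm (tens X Y);
  symm1 : forall X : ssm_cat, symm X unito ≡ idm X;
  symm_tens : forall X Y Z : ssm_cat,
    symm X (tens Y Z)
      ≡ tensm (idm Y) (symm X Z) ⊚ eqid (tensoA Y X Z)
          ⊚ tensm (symm X Y) (idm Z)
}.
Arguments tens {s}.
Arguments unito {s}.
Arguments tensm {s X Y X' Y'}.
Arguments symm {s}.

Notation "X ⊗ Y" := (tens X Y) : smc_scope.
Notation "f ⊠ g" := (tensm f g) : smc_scope.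

Record ssmfunctor (C D : ssmcat) := SSMFunctor {
  fob :> C -> D;
  fhom : forall X Y : C, hom X Y -> hom (fob X) (fob Y);
  fhom_id : forall X : C, fhom (idm X) = idm (fob X);
  fhom_comp : forall (X Y Z : C) (g : hom Y Z) (f : hom X Y),
    fhom (g ⊚ f) = fhom g ⊚ fhom f;
  fob_unit : fob unito = unito;
  fob_tens : forall X Y : C, fob (X ⊗ Y) = fob X ⊗ fob Y;
  fhom_tens : forall (X Y X' Y' : C) (f : hom X Y) (g : hom X' Y'),
    fhom (f ⊠ g) ≡ fhom f ⊠ fhom g;
  fhom_symm : forall X Y : C, fhom (symm X Y) ≡ symm (fob X) (fob Y)
}.
Arguments fhom {C D} s {X Y}.

Section Heq.
Variable C : category.
Implicit Types X Y Z : C.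

Lemma heq_ind X Y (f : hom X Y) (P : forall X' Y', hom X' Y' -> Prop) :
  P X Y f -> forall X' Y' (g : hom X' Y'), f ≡ g -> P X' Y' g.
Proof.
move=> Pf X' Y' g e.
pose Q (a : arrow C) := P (projT1 a) (projT1 (projT2 a)) (projT2 (projT2 a)).
exact: (eq_ind (arr f) Q Pf (arr g) e).
Qed.

Lemma heq_dom X Y X' Y' (f : hom X Y) (g : hom X' Y') : f ≡ g -> X = X'.
Proof. by move=> /(congr1 (fun a => projT1 a)). Qed.

Lemma heq_cod X Y X' Y' (f : hom X Y) (g : hom X' Y') : f ≡ g -> Y = Y'.
Proof. by move=> /(congr1 (fun a => projT1 (projT2 a))). Qed.

Lemma heq_eq X Y (f g : hom X Y) : f ≡ g -> f = g.
Proof.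
move=> e.
pose Q := fun X' Y' (h : hom X' Y') => forall (eX : X = X') (eY : Y = Y'),
  h = ecast U (hom U Y') eX (ecast U (hom X U) eY f).
have /(_ erefl erefl) -> // : Q X Y g.
apply: heq_ind e => eX eY.
by rewrite (Prop_irrelevance eX erefl) (Prop_irrelevance eY erefl).
Qed.

Lemma heq_comp X Y Z X' Y' Z' (g : hom Y Z) (f : hom X Y)
    (g' : hom Y' Z') (f' : hom X' Y') :
  g ≡ g' -> f ≡ f' -> g ⊚ f ≡ g' ⊚ f'.
Proof.
move=> eg ef; have eX := heq_dom ef; have eY := heq_cod ef.
have eZ := heq_cod eg.
by destruct eX, eY, eZ; rewrite (heq_eq ef) (heq_eq eg).
Qed.

Lemma heq_eqidl X Y Z (e : Y = Z) (f : hom X Y) : eqid e ⊚ f ≡ f.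
Proof. by destruct e; rewrite /= comp1m. Qed.

Lemma heq_eqidr X Y Z (e : X = Y) (f : hom Y Z) : f ⊚ eqid e ≡ f.
Proof. by destruct e; rewrite /= compm1. Qed.

Lemma heq_compe X Y Y0 Z X' Y' Y0' Z' (e : Y = Y0) (e' : Y' = Y0')
    (g : hom Y0 Z) (f : hom X Y) (g' : hom Y0' Z') (f' : hom X' Y') :
  g ≡ g' -> f ≡ f' -> g ⊚ eqid e ⊚ f ≡ g' ⊚ eqid e' ⊚ f'.
Proof. by destruct e, e' => eg ef; rewrite /= !comp1m; apply: heq_comp. Qed.

Lemma heq_idm X Y : X = Y -> idm X ≡ idm Y.
Proof. by move->. Qed.

Definition hcast X Y X' Y' (eX : X = X') (eY : Y = Y') (f : hom X Y) :
  hom X' Y' := eqid eY ⊚ f ⊚ eqid (esym eX).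

Lemma heq_hcast X Y X' Y' (eX : X = X') (eY : Y = Y') (f : hom X Y) :
  hcast eX eY f ≡ f.
Proof. by rewrite /hcast heq_eqidl heq_eqidr. Qed.

End Heq.

Lemma heq_tens (C : ssmcat) (X Y Z W X' Y' Z' W' : C)
    (f : hom X Y) (g : hom Z W) (f' : hom X' Y') (g' : hom Z' W') :
  f ≡ f' -> g ≡ g' -> f ⊠ g ≡ f' ⊠ g'.
Proof.
move=> ef eg; have eX := heq_dom ef; have eY := heq_cod ef.
have eZ := heq_dom eg; have eW := heq_cod eg.
by destruct eX, eY, eZ, eW; rewrite (heq_eq ef) (heq_eq eg).
Qed.

Lemma heq_symm (C : ssmcat) (X Y X' Y' : C) :
  X = X' -> Y = Y' -> symm X Y ≡ symm X' Y'.
Proof. by move=> -> ->. Qed.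

Lemma heq_fhom (C D : ssmcat) (T : ssmfunctor C D) (X Y X' Y' : C)
    (f : hom X Y) (g : hom X' Y') : f ≡ g -> fhom T f ≡ fhom T g.
Proof.
by move=> e; apply: (heq_ind (P := fun _ _ h => fhom T f ≡ fhom T h) _ e).
Qed.

Lemma fhom_eqid (C D : ssmcat) (T : ssmfunctor C D) (X Y : C) (e : X = Y) :
  fhom T (eqid e) = eqid (congr1 T e).
Proof. by destruct e; rewrite /= fhom_id. Qed.

Lemma functor_ext (C D : ssmcat) (T T' : ssmfunctor C D) :
  (forall X, T X = T' X) ->
  (forall (X Y : C) (f : hom X Y), fhom T f ≡ fhom T' f) -> T = T'.
Proof.
case: T => t h h1 hc hu ht hm hs; case: T' => t' h' h1' hc' hu' ht' hm' hs' /=.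
move=> /funext e; destruct e => eh.
have e : h = h'.
  by do 3![apply: functional_extensionality_dep => ?]; apply: heq_eq.
by destruct e; congr SSMFunctor; apply: Prop_irrelevance.
Qed.

Program Definition functor_id (C : ssmcat) : ssmfunctor C C :=
  @SSMFunctor C C (fun X => X) (fun X Y f => f) _ _ _ _ _ _.
Solve Obligations with by [].

Program Definition functor_comp (C D E : ssmcat)
    (G : ssmfunctor D E) (T : ssmfunctor C D) : ssmfunctor C E :=
  @SSMFunctor C E (fun X => G (T X)) (fun X Y f => fhom G (fhom T f))
    _ _ _ _ _ _.
Next Obligation. by move=> * /=; rewrite !fhom_id. Qed.
Next Obligation. by move=> * /=; rewrite !fhom_comp. Qed.
Next Obligation. by move=> * /=; rewrite !fob_unit. Qed.
Next Obligation. by move=> * /=; rewrite !fob_tens. Qed.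
Next Obligation.
by move=> C D E G T * /=; rewrite (heq_fhom G (fhom_tens T _ _)) fhom_tens.
Qed.
Next Obligation.
by move=> C D E G T * /=; rewrite (heq_fhom G (fhom_symm T _ _)) fhom_symm.
Qed.

Definition is_ssm_isomorphism (C D : ssmcat) (T : ssmfunctor C D) : Prop :=
  exists G : ssmfunctor D C,
    functor_comp G T = functor_id C /\ functor_comp T G = functor_id D.

Lemma tens_mid (C : ssmcat) (X Y Z W : C) :
  (X ⊗ Y) ⊗ (Z ⊗ W) = X ⊗ (Y ⊗ Z) ⊗ W.
Proof. by rewrite !tensoA. Qed.

Record hopf_monoid (C : ssmcat) := HopfMonoid {
  hob :> C;
  hmu : hom (hob ⊗ hob) hob;
  heta : hom unito hob;
  hdelta : hom hob (hob ⊗ hob);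
  heps : hom hob unito;
  hanti : hom hob hob;
  hmuA : hmu ⊚ (hmu ⊠ idm hob) ≡ hmu ⊚ (idm hob ⊠ hmu);
  hmu1m : hmu ⊚ (heta ⊠ idm hob) ≡ idm hob;
  hmum1 : hmu ⊚ (idm hob ⊠ heta) ≡ idm hob;
  hdeltaA : (hdelta ⊠ idm hob) ⊚ hdelta ≡ (idm hob ⊠ hdelta) ⊚ hdelta;
  hdelta1m : (heps ⊠ idm hob) ⊚ hdelta ≡ idm hob;
  hdeltam1 : (idm hob ⊠ heps) ⊚ hdelta ≡ idm hob;
  heps_eta : heps ⊚ heta = idm unito;
  heps_mu : heps ⊚ hmu ≡ heps ⊠ heps;
  hdelta_eta : hdelta ⊚ heta ≡ heta ⊠ heta;
  hdelta_mu : hdelta ⊚ hmu =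
    (hmu ⊠ hmu) ⊚ eqid (esym (tens_mid hob hob hob hob))
      ⊚ (idm hob ⊠ symm hob hob ⊠ idm hob)
      ⊚ eqid (tens_mid hob hob hob hob) ⊚ (hdelta ⊠ hdelta);
  hanti_r : hmu ⊚ (idm hob ⊠ hanti) ⊚ hdelta = heta ⊚ heps;
  hanti_l : hmu ⊚ (hanti ⊠ idm hob) ⊚ hdelta = heta ⊚ heps
}.

Record comm_hopf_monoid (C : ssmcat) := CommHopfMonoid {
  comm_hopf :> hopf_monoid C;
  hmuC : hmu comm_hopf ⊚ symm comm_hopf comm_hopf = hmu comm_hopf
}.

Definition maps_hopf (C D : ssmcat) (T : ssmfunctor C D)
    (A : hopf_monoid C) (B : hopf_monoid D) : Prop :=
  T A = B /\
  [/\ fhom T (hmu A) ≡ hmu B, fhom T (heta A) ≡ heta B,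
      fhom T (hdelta A) ≡ hdelta B, fhom T (heps A) ≡ heps B &
      fhom T (hanti A) ≡ hanti B].

Inductive term : nat -> nat -> Type :=
| Tid n : term n n
| Tcomp m n p : term n p -> term m n -> term m p
| Ttens m n m' n' : term m n -> term m' n' -> term (m + m') (n + n')
| Tsymm m n : term (m + n) (n + m)
| Tmu : term (1 + 1) 1
| Teta : term 0 1
| Tdelta : term 1 (1 + 1)
| Teps : term 1 0
| Tanti : term 1 1.

Definition Teqid m n (e : m = n) : term m n :=
  match e in _ = k return term m k with erefl => Tid m end.

Lemma addnAV m n p : m + n + p = m + (n + p). Proof. by rewrite addnA. Qed.

Lemma addn_mid m n p q : m + n + (p + q) = m + (n + p) + q.
Proof. by rewrite !addnA. Qed.

(* The congruence generated by the axioms of [category], [ssmcat], [hopf_monoid]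
   and [comm_hopf_monoid]. It is heterogeneous for the same reason as [≡];
   related terms always have equal sources and targets ([term_eq_type]). Object
   equalities need no rules since the objects are the integers themselves. *)
Inductive term_eq : forall m n m' n', term m n -> term m' n' -> Prop :=
| E_refl m n (s : term m n) : s ≈ s
| E_sym m n m' n' (s : term m n) (t : term m' n') : s ≈ t -> t ≈ s
| E_trans m n m' n' m'' n''
    (s : term m n) (t : term m' n') (u : term m'' n'') :
    s ≈ t -> t ≈ u -> s ≈ u
| E_comp m n p m' n' p' (s : term n p) (t : term m n)
    (s' : term n' p') (t' : term m' n') :
    s ≈ s' -> t ≈ t' -> Tcomp s t ≈ Tcomp s' t'
| E_tens m n k l m' n' k' l' (s : term m n) (t : term k l)
    (s' : term m' n') (t' : term k' l') :
    s ≈ s' -> t ≈ t' -> Ttens s t ≈ Ttens s' t'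
| E_compA m n p q (h : term p q) (g : term n p) (f : term m n) :
    Tcomp h (Tcomp g f) ≈ Tcomp (Tcomp h g) f
| E_comp1m m n (f : term m n) : Tcomp (Tid n) f ≈ f
| E_compm1 m n (f : term m n) : Tcomp f (Tid m) ≈ f
| E_tens_id m n : Ttens (Tid m) (Tid n) ≈ Tid (m + n)
| E_tens_comp m n p m' n' p' (g : term n p) (f : term m n)
    (g' : term n' p') (f' : term m' n') :
    Ttens (Tcomp g f) (Tcomp g' f') ≈ Tcomp (Ttens g g') (Ttens f f')
| E_tensmA m n m' n' m'' n''
    (f : term m n) (g : term m' n') (h : term m'' n'') :
    Ttens (Ttens f g) h ≈ Ttens f (Ttens g h)
| E_tens1m m n (f : term m n) : Ttens (Tid 0) f ≈ f
| E_tensm1 m n (f : term m n) : Ttens f (Tid 0) ≈ f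
| E_symm_nat m n m' n' (f : term m n) (g : term m' n') :
    Tcomp (Tsymm n n') (Ttens f g) ≈ Tcomp (Ttens g f) (Tsymm m m')
| E_symmK m n : Tcomp (Tsymm n m) (Tsymm m n) ≈ Tid (m + n)
| E_symm1 n : Tsymm n 0 ≈ Tid n
| E_symm_tens m n p :
    Tsymm m (n + p)
      ≈ Tcomp (Ttens (Tid n) (Tsymm m p))
          (Tcomp (Teqid (addnAV n m p)) (Ttens (Tsymm m n) (Tid p)))
| E_muA : Tcomp Tmu (Ttens Tmu (Tid 1)) ≈ Tcomp Tmu (Ttens (Tid 1) Tmu)
| E_mu1m : Tcomp Tmu (Ttens Teta (Tid 1)) ≈ Tid 1
| E_mum1 : Tcomp Tmu (Ttens (Tid 1) Teta) ≈ Tid 1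
| E_deltaA :
    Tcomp (Ttens Tdelta (Tid 1)) Tdelta ≈ Tcomp (Ttens (Tid 1) Tdelta) Tdelta
| E_delta1m : Tcomp (Ttens Teps (Tid 1)) Tdelta ≈ Tid 1
| E_deltam1 : Tcomp (Ttens (Tid 1) Teps) Tdelta ≈ Tid 1
| E_eps_eta : Tcomp Teps Teta ≈ Tid 0
| E_eps_mu : Tcomp Teps Tmu ≈ Ttens Teps Teps
| E_delta_eta : Tcomp Tdelta Teta ≈ Ttens Teta Teta
| E_delta_mu :
    Tcomp Tdelta Tmu
      ≈ Tcomp (Ttens Tmu Tmu)
          (Tcomp (Teqid (esym (addn_mid 1 1 1 1)))
             (Tcomp (Ttens (Ttens (Tid 1) (Tsymm 1 1)) (Tid 1))
                (Tcomp (Teqid (addn_mid 1 1 1 1)) (Ttens Tdelta Tdelta))))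
| E_anti_r : Tcomp Tmu (Tcomp (Ttens (Tid 1) Tanti) Tdelta) ≈ Tcomp Teta Teps
| E_anti_l : Tcomp Tmu (Tcomp (Ttens Tanti (Tid 1)) Tdelta) ≈ Tcomp Teta Teps
| E_muC : Tcomp Tmu (Tsymm 1 1) ≈ Tmu
where "s ≈ t" := (term_eq s t).

Lemma term_eq_type m n m' n' (s : term m n) (t : term m' n') :
  s ≈ t -> m = m' /\ n = n'.
Proof.
elim=> {m n m' n' s t} //=.
- by move=> m n m' n' s t _ [-> ->].
- by move=> m n m' n' m'' n'' s t u _ [-> ->].
- by move=> m n p m' n' p' s t s' t' _ [_ ->] _ [-> _].
- by move=> m n k l m' n' k' l' s t s' t' _ [-> ->] _ [-> ->].
- by move=> m n m' n' m'' n'' f g h; rewrite !addnA.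
- by move=> m n f; rewrite !addn0.
- by move=> n; rewrite addn0.
- by move=> m n p; rewrite !addnA.
Qed.

Section HomH.
Variables m n : nat.
Implicit Types s t : {classic term m n}.

Definition term_eqb s t : bool := `[< term_eq s t >].

Lemma term_eqb_refl : reflexive term_eqb.
Proof. by move=> s; apply/asboolP/E_refl. Qed.

Lemma term_eqb_sym : symmetric term_eqb.
Proof. by move=> s t; apply/asboolP/asboolP => /E_sym. Qed.

Lemma term_eqb_trans : transitive term_eqb.
Proof. by move=> t s u /asboolP st /asboolP tu; apply/asboolP/E_trans/tu. Qed.

Canonical term_equiv := EquivRel term_eqb
  term_eqb_refl term_eqb_sym term_eqb_trans.

Definition homH := {eq_quot term_equiv}%qT.

Definition tcls (t : term m n) : homH := (\pi_homH (t : {classic term m n}))%qT.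

Definition trepr (f : homH) : term m n := repr f.

Lemma treprK f : tcls (trepr f) = f.
Proof. exact: reprK. Qed.

Lemma tclsP (s t : term m n) : tcls s = tcls t <-> s ≈ t.
Proof.
by split=> [/eqmodP/asboolP //|st]; apply/eqmodP/asboolP.
Qed.

Lemma trepr_cls (t : term m n) : trepr (tcls t) ≈ t.
Proof. by apply/tclsP; rewrite treprK. Qed.

End HomH.

Definition compH m n p (g : homH n p) (f : homH m n) : homH m p :=
  tcls (Tcomp (trepr g) (trepr f)).
Definition tensH m n m' n' (f : homH m n) (g : homH m' n') :
  homH (m + m') (n + n') := tcls (Ttens (trepr f) (trepr g)).

Lemma compHE m n p (g : term n p) (f : term m n) :
  compH (tcls g) (tcls f) = tcls (Tcomp g f).
Proof. by apply/tclsP; apply: E_comp; apply: trepr_cls. Qed.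

Lemma tensHE m n m' n' (f : term m n) (g : term m' n') :
  tensH (tcls f) (tcls g) = tcls (Ttens f g).
Proof. by apply/tclsP; apply: E_tens; apply: trepr_cls. Qed.

Program Definition catH : category :=
  @Category nat homH (fun n => tcls (Tid n)) compH _ _ _.
Next Obligation.
move=> m n p q h g f; rewrite -[h]treprK -[g]treprK -[f]treprK !compHE.
exact/tclsP/E_compA.
Qed.
Next Obligation.
by move=> m n f; rewrite -[f]treprK compHE; apply/tclsP/E_comp1m.
Qed.
Next Obligation.
by move=> m n f; rewrite -[f]treprK compHE; apply/tclsP/E_compm1.
Qed.

Lemma tcls_heq m n m' n' (s : term m n) (t : term m' n') :
  s ≈ t -> arr (tcls s : @hom catH m n) = arr (tcls t : @hom catH m' n').
Proof.
move=> st; have [em en] := term_eq_type st; destruct em, en.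
by congr (arr _); apply/tclsP.
Qed.

Lemma tcls_eqid m n (e : m = n) : tcls (Teqid e) = @eqid catH m n e.
Proof. by destruct e. Qed.

Program Definition ssmH : ssmcat :=
  @SSMCat catH addn 0 tensH (fun m n => tcls (Tsymm m n))
    _ _ addnAV add0n addn0 _ _ _ _ _ _ _.
Next Obligation.
by move=> m n; rewrite /= tensHE; apply/tclsP/E_tens_id.
Qed.
Next Obligation.
move=> m n p m' n' p' g f g' f' /=.
rewrite -[g]treprK -[g']treprK -[f]treprK -[f']treprK !(compHE, tensHE).
exact/tclsP/E_tens_comp.
Qed.
Next Obligation.
move=> m n m' n' m'' n'' f g h /=.
rewrite -[f]treprK -[g]treprK -[h]treprK !tensHE.
exact/tcls_heq/E_tensmA.
Qed.
Next Obligation.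
by move=> m n f; rewrite -[f]treprK /= tensHE; apply/tcls_heq/E_tens1m.
Qed.
Next Obligation.
by move=> m n f; rewrite -[f]treprK /= tensHE; apply/tcls_heq/E_tensm1.
Qed.
Next Obligation.
move=> m n m' n' f g /=; rewrite -[f]treprK -[g]treprK !(compHE, tensHE).
exact/tclsP/E_symm_nat.
Qed.
Next Obligation. by move=> m n /=; rewrite !compHE; apply/tclsP/E_symmK. Qed.
Next Obligation. by move=> n /=; apply/tcls_heq/E_symm1. Qed.
Next Obligation.
move=> m n p /=; rewrite -tcls_eqid !(compHE, tensHE).
exact/tcls_heq/E_symm_tens.
Qed.

Lemma eqidH m n (e : m = n) :
  @eqid ssmH m n e = tcls (Teqid e).
Proof. by rewrite tcls_eqid. Qed.

Lemma TeqidE n (e : n = n) : Teqid e = Tid n.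
Proof. by rewrite (eq_irrelevance e erefl). Qed.

Program Definition hopfH : hopf_monoid ssmH :=
  @HopfMonoid ssmH 1 (tcls Tmu) (tcls Teta) (tcls Tdelta) (tcls Teps)
    (tcls Tanti) _ _ _ _ _ _ _ _ _ _ _ _.
Next Obligation. by rewrite /= !(tensHE, compHE); apply/tcls_heq/E_muA. Qed.
Next Obligation. by rewrite /= !(tensHE, compHE); apply/tcls_heq/E_mu1m. Qed.
Next Obligation. by rewrite /= !(tensHE, compHE); apply/tcls_heq/E_mum1. Qed.
Next Obligation. by rewrite /= !(tensHE, compHE); apply/tcls_heq/E_deltaA. Qed.
Next Obligation.
by rewrite /= !(tensHE, compHE); apply/tcls_heq/E_delta1m.
Qed.
Next Obligation.
by rewrite /= !(tensHE, compHE); apply/tcls_heq/E_deltam1.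
Qed.
Next Obligation. by rewrite /= !(tensHE, compHE); apply/tclsP/E_eps_eta. Qed.
Next Obligation. by rewrite /= !(tensHE, compHE); apply/tcls_heq/E_eps_mu. Qed.
Next Obligation.
by rewrite /= !(tensHE, compHE); apply/tcls_heq/E_delta_eta.
Qed.
Next Obligation.
rewrite (Prop_irrelevance (@tens_mid ssmH 1 1 1 1) (addn_mid 1 1 1 1)).
by rewrite !eqidH /= !(tensHE, compHE); apply/tclsP/E_delta_mu.
Qed.
Next Obligation. by rewrite /= !(tensHE, compHE); apply/tclsP/E_anti_r. Qed.
Next Obligation. by rewrite /= !(tensHE, compHE); apply/tclsP/E_anti_l. Qed.

Program Definition comm_hopfH : comm_hopf_monoid ssmH :=
  @CommHopfMonoid ssmH hopfH _.
Next Obligation. by rewrite /= !(tensHE, compHE); apply/tclsP/E_muC. Qed.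

Section Free.
Variables (C : ssmcat) (A : comm_hopf_monoid C).

Fixpoint hpow (n : nat) : C := if n is k.+1 then A ⊗ hpow k else unito.

Lemma hpow1 : hpow 1 = A. Proof. exact: tenso1. Qed.

Lemma hpowD m n : hpow (m + n) = hpow m ⊗ hpow n.
Proof.
elim: m => [|m IHm]; first by rewrite /= tens1o.
by rewrite addSn /= IHm tensoA.
Qed.

Lemma hpow2 : hpow (1 + 1) = A ⊗ A.
Proof. by rewrite hpowD hpow1. Qed.

Fixpoint interp m n (t : term m n) : hom (hpow m) (hpow n) :=
  match t with
  | Tid n => idm (hpow n)
  | Tcomp _ _ _ g f => interp g ⊚ interp f
  | Ttens _ _ _ _ f g =>
      hcast (esym (hpowD _ _)) (esym (hpowD _ _)) (interp f ⊠ interp g)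
  | Tsymm m n =>
      hcast (esym (hpowD _ _)) (esym (hpowD _ _)) (symm (hpow m) (hpow n))
  | Tmu => hcast (esym hpow2) (esym hpow1) (hmu A)
  | Teta => hcast erefl (esym hpow1) (heta A)
  | Tdelta => hcast (esym hpow1) (esym hpow2) (hdelta A)
  | Teps => hcast (esym hpow1) erefl (heps A)
  | Tanti => hcast (esym hpow1) (esym hpow1) (hanti A)
  end.

Lemma interp_tens m n m' n' (f : term m n) (g : term m' n') :
  interp (Ttens f g) ≡ interp f ⊠ interp g.
Proof. exact: heq_hcast. Qed.

Lemma interp_symm m n : interp (Tsymm m n) ≡ symm (hpow m) (hpow n).
Proof. exact: heq_hcast. Qed.

Lemma interp_eqid m n (e : m = n) : interp (Teqid e) = eqid (congr1 hpow e).
Proof. by destruct e. Qed.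

Lemma interp_hopf :
  [/\ interp Tmu ≡ hmu A, interp Teta ≡ heta A, interp Tdelta ≡ hdelta A,
      interp Teps ≡ heps A & interp Tanti ≡ hanti A].
Proof. by split; apply: heq_hcast. Qed.

Lemma interp_id1 : interp (Tid 1) ≡ idm A.
Proof. by rewrite /= tenso1. Qed.

Lemma interp_eq m n m' n' (s : term m n) (t : term m' n') :
  s ≈ t -> interp s ≡ interp t.
Proof.
have [muE etaE deltaE epsE antiE] := interp_hopf; have id1 := interp_id1.
have id0 : interp (Tid 0) ≡ idm unito by [].
elim=> {m n m' n' s t} //.
- by move=> m n m' n' m'' n'' s t u _ -> _ ->.
- by move=> *; apply: heq_comp.
- by move=> *; rewrite !interp_tens; apply: heq_tens.
- by move=> * /=; rewrite compA.
- by move=> * /=; rewrite comp1m.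
- by move=> * /=; rewrite compm1.
- by move=> m n; rewrite interp_tens /= tens_id -hpowD.
- move=> *; rewrite interp_tens /= tens_comp.
  by apply: heq_comp; rewrite heq_hcast.
- move=> m n m' n' m'' n'' f g h; rewrite !interp_tens.
  rewrite (heq_tens (interp_tens f g) erefl) tensmA.
  by apply: heq_tens => //; rewrite interp_tens.
- by move=> m n f; rewrite interp_tens tens1m.
- by move=> m n f; rewrite interp_tens tensm1.
- move=> m n m' n' f g /=.
  rewrite (heq_comp (interp_symm n n') (interp_tens f g)) symm_nat.
  by apply: heq_comp; rewrite heq_hcast.
- move=> m n /=.
  by rewrite (heq_comp (interp_symm n m) (interp_symm m n)) symmK -hpowD.
- by move=> n; rewrite interp_symm symm1.
- move=> m n p; rewrite interp_symm [interp (Tcomp _ _)]/= interp_eqid.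
  rewrite (heq_symm (erefl (hpow m)) (hpowD n p)) symm_tens.
  apply: heq_compe.
    by rewrite heq_hcast; apply: heq_tens => //; rewrite heq_hcast.
  by rewrite heq_hcast; apply: heq_tens => //; rewrite heq_hcast.
- rewrite (heq_comp muE (etrans (interp_tens _ _) (heq_tens muE id1))) hmuA.
  by rewrite (heq_comp muE (etrans (interp_tens _ _) (heq_tens id1 muE))).
- rewrite (heq_comp muE (etrans (interp_tens _ _) (heq_tens etaE id1))).
  by rewrite hmu1m id1.
- rewrite (heq_comp muE (etrans (interp_tens _ _) (heq_tens id1 etaE))).
  by rewrite hmum1 id1.
- rewrite (heq_comp (etrans (interp_tens _ _) (heq_tens deltaE id1)) deltaE).
  rewrite hdeltaA.
  by rewrite (heq_comp (etrans (interp_tens _ _) (heq_tens id1 deltaE)) deltaE).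
- rewrite (heq_comp (etrans (interp_tens _ _) (heq_tens epsE id1)) deltaE).
  by rewrite hdelta1m id1.
- rewrite (heq_comp (etrans (interp_tens _ _) (heq_tens id1 epsE)) deltaE).
  by rewrite hdeltam1 id1.
- by rewrite (heq_comp epsE etaE) heps_eta.
- by rewrite (heq_comp epsE muE) heps_mu interp_tens; apply: heq_tens.
- by rewrite (heq_comp deltaE etaE) hdelta_eta interp_tens; apply: heq_tens.
- rewrite (heq_comp deltaE muE) hdelta_mu.
  apply: esym; rewrite [interp (Tcomp _ _)]/=.
  have E1 := etrans (interp_tens Tmu Tmu) (heq_tens muE muE).
  have E2 := etrans (interp_tens Tdelta Tdelta) (heq_tens deltaE deltaE).
  have E3 : interp (Ttens (Ttens (Tid 1) (Tsymm 1 1)) (Tid 1))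
              ≡ (idm (A : C) ⊠ symm (A : C) A) ⊠ idm (A : C).
    rewrite interp_tens; apply: heq_tens => //; rewrite interp_tens.
    by apply: heq_tens => //; rewrite interp_symm; apply: heq_symm; apply: hpow1.
  rewrite !interp_eqid /=; apply: heq_compe => //.
  exact: heq_compe.
- rewrite (heq_comp muE (heq_comp (etrans (interp_tens _ _)
    (heq_tens id1 antiE)) deltaE)) hanti_r.
  by rewrite (heq_comp etaE epsE).
- rewrite (heq_comp muE (heq_comp (etrans (interp_tens _ _)
    (heq_tens antiE id1)) deltaE)) hanti_l.
  by rewrite (heq_comp etaE epsE).
- rewrite (heq_comp muE (etrans (interp_symm 1 1) (heq_symm hpow1 hpow1))).
  by rewrite hmuC muE.
Qed.

Definition interpH m n (f : @hom ssmH m n) : hom (hpow m) (hpow n) :=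
  interp (trepr f).

Lemma interpHE m n (t : term m n) : interpH (tcls t) = interp t.
Proof. exact/heq_eq/interp_eq/trepr_cls. Qed.

Program Definition freeH_functor : ssmfunctor ssmH C :=
  @SSMFunctor ssmH C hpow interpH _ _ _ hpowD _ _.
Next Obligation. by move=> n; rewrite /= interpHE. Qed.
Next Obligation.
move=> m n p g f; rewrite -[f]treprK -[g]treprK /= compHE !interpHE.
by [].
Qed.
Next Obligation. by []. Qed.
Next Obligation.
move=> m n m' n' f g; rewrite -[f]treprK -[g]treprK /= tensHE !interpHE.
exact: interp_tens.
Qed.
Next Obligation. by move=> m n /=; rewrite interpHE; apply: interp_symm. Qed.

Lemma freeH_functor_hopf : maps_hopf freeH_functor comm_hopfH A.
Proof.
have [muE etaE deltaE epsE antiE] := interp_hopf.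
by split; [exact: hpow1 | split; rewrite /= interpHE].
Qed.

Lemma freeH_unique (T : ssmfunctor ssmH C) :
  maps_hopf T comm_hopfH A -> T = freeH_functor.
Proof.
case=> T1 [muE etaE deltaE epsE antiE].
have Tob n : T n = hpow n.
  elim: n => [|n IHn]; first exact: (fob_unit T).
  by rewrite -[n.+1]/((1 : ssmH) ⊗ (n : ssmH)) fob_tens T1 IHn.
apply: functor_ext => // m n f.
rewrite -(treprK f) [fhom freeH_functor _]interpHE.
elim: (trepr f) => {m n f} /=.
- by move=> n; rewrite -[tcls _]/(@idm ssmH n) fhom_id; apply: heq_idm.
- move=> m n p g IHg f IHf; rewrite -compHE (fhom_comp T).
  exact: heq_comp.
- move=> m n m' n' f IHf g IHg; rewrite -tensHE (fhom_tens T).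
  by rewrite heq_hcast; apply: heq_tens.
- by move=> m n; rewrite heq_hcast (fhom_symm T); apply: heq_symm.
- by rewrite heq_hcast.
- by rewrite heq_hcast.
- by rewrite heq_hcast.
- by rewrite heq_hcast.
- by rewrite heq_hcast.
Qed.

Theorem freeH : exists! T : ssmfunctor ssmH C, maps_hopf T comm_hopfH A.
Proof.
exists freeH_functor; split; first exact: freeH_functor_hopf.
by move=> T /freeH_unique.
Qed.

End Free.

Section FreeGroup.
Local Open Scope group_scope.
Variable X : choiceType.

(* (x, false) is the letter x, (x, true) is the letter x^-1. *)
Definition letter := (X * bool)%type.
Implicit Types (a b : letter) (u v w : seq letter).

Definition linv a : letter := (a.1, ~~ a.2).

Definition reduced w := sorted (fun a b => b != linv a) w.

Definition lcons a w :=
  if w is b :: w' then if b == linv a then w' else a :: w else [:: a].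

Lemma linvK : involutive linv.
Proof. by case=> x b; rewrite /linv /= negbK. Qed.

Lemma linv_neq a : (a == linv a) = false.
Proof. by case: a => x []; apply/eqP => -[]. Qed.

Lemma reduced_behead a w : reduced (a :: w) -> reduced w.
Proof. exact: path_sorted. Qed.

Lemma lcons_reduced a w : reduced w -> reduced (lcons a w).
Proof.
case: w => //= b w; case: ifPn => [_ /path_sorted //|ba bw].
by rewrite /reduced /= ba.
Qed.

Lemma lconsE a w : reduced (a :: w) -> lcons a w = a :: w.
Proof. by case: w => //= b w /andP[/negPf ->]. Qed.

Lemma lconsK a w : reduced w -> lcons (linv a) (lcons a w) = w.
Proof.
case: w => [|b w] rw /=; first by rewrite linvK eqxx.
case: eqP => [eb|_] /=; last by rewrite linvK eqxx.
by rewrite -eb lconsE.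
Qed.

Lemma foldr_lcons_reduced u w : reduced w -> reduced (foldr lcons w u).
Proof. by move=> rw; elim: u => //= a u; apply: lcons_reduced. Qed.

Lemma foldr_lcons_nil u : reduced u -> foldr lcons [::] u = u.
Proof.
by elim: u => //= a u IHu ru; rewrite IHu ?lconsE ?(reduced_behead ru).
Qed.

Lemma foldr_lcons_lcons w a u : reduced w ->
  foldr lcons w (lcons a u) = lcons a (foldr lcons w u).
Proof.
case: u => //= b u rw; case: eqP => [->|//].
by rewrite -{1}(linvK a) lconsK // foldr_lcons_reduced.
Qed.

Lemma foldr_lconsA u v w : reduced w ->
  foldr lcons (foldr lcons w v) u = foldr lcons w (foldr lcons v u).
Proof. by move=> rw; elim: u => //= a u ->; rewrite foldr_lcons_lcons. Qed.

Definition winv w := rev (map linv w).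

Lemma winvK : involutive winv.
Proof. by move=> w; rewrite /winv map_rev revK (mapK linvK). Qed.

Lemma winv_reduced w : reduced w -> reduced (winv w).
Proof.
rewrite /reduced /winv rev_sorted sorted_map; apply: sub_sorted => a b /=.
by apply: contraNN => /eqP ->; rewrite linvK.
Qed.

Lemma winv_foldr w : foldr lcons w (winv w) = [::].
Proof.
rewrite /winv -(foldl_rev (fun v a => lcons a v)) revK; elim: w => //= a w IHw.
by rewrite linvK eqxx.
Qed.

Record free_group := FreeGroup { fword : seq letter; _ : reduced fword }.

HB.instance Definition _ := [isSub for fword].
HB.instance Definition _ := [Choice of free_group by <:].

Implicit Types x y z : free_group.

Definition fg1 : free_group := @FreeGroup [::] isT.
Definition fgmul x y : free_group :=
  FreeGroup (foldr_lcons_reduced (fword x) (valP y)).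
Definition fginv x : free_group := FreeGroup (winv_reduced (valP x)).

Fact fgmulA : associative fgmul.
Proof. by move=> x y z; apply/val_inj/foldr_lconsA/(valP z). Qed.
Fact fgmul1 : left_id fg1 fgmul.
Proof. by move=> x; apply: val_inj. Qed.
Fact fgmulr1 : right_id fg1 fgmul.
Proof. by move=> x; apply/val_inj/foldr_lcons_nil/(valP x). Qed.
Fact fgmulV : left_inverse fg1 fginv fgmul.
Proof. by move=> x; apply/val_inj/winv_foldr. Qed.
Fact fgmulrV : right_inverse fg1 fginv fgmul.
Proof.
move=> x; apply: val_inj.
by have := winv_foldr (winv (fword x)); rewrite winvK.
Qed.

HB.instance Definition _ := isGroup.Build free_group
  fgmulA fgmul1 fgmulr1 fgmulV fgmulrV.

Definition fgen (i : X) : free_group := @FreeGroup [:: (i, false)] isT.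

End FreeGroup.

Notation group_hom := UMagmaMorphism.type.

Section FreeGroupLift.
Local Open Scope group_scope.
Variables (X : choiceType) (G : groupType).

Lemma group_hom_inj (H : groupType) (f g : group_hom H G) : f =1 g -> f = g.
Proof.
case: f g => f [[fM] [f1]] [g [[gM] [g1]]] /= /funext e; destruct e.
by rewrite (Prop_irrelevance fM gM) (Prop_irrelevance f1 g1).
Qed.

Lemma free_group_ext (f g : group_hom (free_group X) G) :
  (forall i, f (fgen i) = g (fgen i)) -> f = g.
Proof.
move=> fg; apply: group_hom_inj => -[w]; elim: w => [|[i b] w IHw] rw.
  by rewrite (_ : FreeGroup rw = 1) ?gmulf1 //; apply: val_inj.
have rw' := reduced_behead rw.
have -> : FreeGroup rw
    = (if b then (fgen i)^-1 else fgen i) * FreeGroup rw' :> free_group X.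
  by apply: val_inj; case: b rw => rw /=; rewrite lconsE.
by rewrite !gmulfM IHw; case: b {rw}; rewrite ?gmulfV fg.
Qed.

Variable f : X -> G.

Definition leval (a : letter X) : G := if a.2 then (f a.1)^-1 else f a.1.

Definition weval (w : seq (letter X)) : G :=
  foldr (fun a g => leval a * g) 1 w.

Lemma levalV a : leval (linv a) = (leval a)^-1.
Proof. by case: a => i []; rewrite /leval /= ?invgK. Qed.

Lemma weval_lcons a w : weval (lcons a w) = leval a * weval w.
Proof.
case: w => //= b w; case: eqP => [->|//].
by rewrite levalV mulgA mulgV mul1g.
Qed.

End FreeGroupLift.

(* Locked, so that unification does not unfold the words. *)
HB.lock Definition flift_fun (X : choiceType) (G : groupType) (f : X -> G)
  (x : free_group X) : G := weval f (fword x).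

Section FreeGroupLift.
Local Open Scope group_scope.
Variables (X : choiceType) (G : groupType) (f : X -> G).

Fact flift_monoid : monoid_morphism (flift_fun f).
Proof.
split=> [|[u ru] [v rv]]; rewrite flift_fun.unlock //=.
by elim: u {ru} => [|a u IHu] /=; rewrite ?mul1g // weval_lcons IHu mulgA.
Qed.

HB.instance Definition _ :=
  isUMagmaMorphism.Build (free_group X) G (flift_fun f) flift_monoid.

Definition flift : group_hom (free_group X) G := flift_fun f.

Lemma flift_gen i : flift (fgen i) = f i.
Proof. by rewrite /= flift_fun.unlock; apply: mulg1. Qed.

End FreeGroupLift.

Definition freeg (n : nat) : groupType := free_group 'I_n.

Definition x_ n (i : 'I_n) : freeg n := fgen i.

(* [homF w] is the homomorphism [w_1, ..., w_m]_{m,n}; generators are indexed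
   from 0. *)
Definition homF m n (w : 'I_m -> freeg n) : group_hom (freeg m) (freeg n) :=
  flift w.

Arguments homF : simpl never.

Lemma homFE m n (w : 'I_m -> freeg n) i : homF w (x_ i) = w i.
Proof. exact: flift_gen. Qed.

Lemma homF_ext m (G : groupType) (f g : group_hom (freeg m) G) :
  (forall i, f (x_ i) = g (x_ i)) -> f = g.
Proof. exact: free_group_ext. Qed.

Program Definition catF : category :=
  @Category nat (fun m n => group_hom (freeg m) (freeg n))
    (fun n => (idfun : group_hom (freeg n) (freeg n)))
    (fun m n p g f => (g \o f : group_hom (freeg m) (freeg p))) _ _ _.
Next Obligation. by move=> *; apply: group_hom_inj. Qed.
Next Obligation. by move=> *; apply: group_hom_inj. Qed.
Next Obligation. by move=> *; apply: group_hom_inj. Qed.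

(* The inclusion x_i |-> x_i, which the usual definition of f ⊗ f' leaves
   implicit, and the shift s_m : x_i |-> x_(m + i). *)
Definition inclF m n : group_hom (freeg m) (freeg (m + n)) :=
  homF (fun i => x_ (lshift n i)).
Definition shiftF m n : group_hom (freeg n) (freeg (m + n)) :=
  homF (fun i => x_ (rshift m i)).

Definition tensF m n m' n' (f : group_hom (freeg m) (freeg n))
    (f' : group_hom (freeg m') (freeg n')) :
  group_hom (freeg (m + m')) (freeg (n + n')) :=
  homF (fun i => match split i with
    | inl j => inclF n n' (f (x_ j))
    | inr j => shiftF n n' (f' (x_ j))
    end).

Definition symmF m n : group_hom (freeg (m + n)) (freeg (n + m)) :=
  homF (fun i => match split i with
    | inl j => x_ (rshift n j)
    | inr j => x_ (lshift m j)
    end).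

Arguments inclF : simpl never.
Arguments shiftF : simpl never.
Arguments tensF : simpl never.
Arguments symmF : simpl never.

Lemma inclFE m n i : inclF m n (x_ i) = x_ (lshift n i).
Proof. exact: homFE. Qed.

Lemma shiftFE m n i : shiftF m n (x_ i) = x_ (rshift m i).
Proof. exact: homFE. Qed.

Section TensF.
Variables (m n m' n' : nat).
Variables (f : group_hom (freeg m) (freeg n)).
Variables (f' : group_hom (freeg m') (freeg n')).

Lemma tensFl i : tensF f f' (x_ (lshift m' i)) = inclF n n' (f (x_ i)).
Proof. by rewrite homFE (unsplitK (inl i)). Qed.

Lemma tensFr i : tensF f f' (x_ (rshift m i)) = shiftF n n' (f' (x_ i)).
Proof. by rewrite homFE (unsplitK (inr i)). Qed.

Lemma tensF_incl w : tensF f f' (inclF m m' w) = inclF n n' (f w).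
Proof.
apply: (congr1 (fun h : group_hom _ _ => h w) (_ :
  (tensF f f' \o inclF m m' : group_hom _ _) = inclF n n' \o f)).
by apply: homF_ext => i; rewrite /= inclFE tensFl.
Qed.

Lemma tensF_shift w : tensF f f' (shiftF m m' w) = shiftF n n' (f' w).
Proof.
apply: (congr1 (fun h : group_hom _ _ => h w) (_ :
  (tensF f f' \o shiftF m m' : group_hom _ _) = shiftF n n' \o f')).
by apply: homF_ext => i; rewrite /= shiftFE tensFr.
Qed.

End TensF.

Lemma symmFl m n i : symmF m n (x_ (lshift n i)) = x_ (rshift n i).
Proof. by rewrite homFE (unsplitK (inl i)). Qed.

Lemma symmFr m n i : symmF m n (x_ (rshift m i)) = x_ (lshift m i).
Proof. by rewrite homFE (unsplitK (inr i)). Qed.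

Lemma symmF_incl m n w : symmF m n (inclF m n w) = shiftF n m w.
Proof.
apply: (congr1 (fun h : group_hom _ _ => h w) (_ :
  (symmF m n \o inclF m n : group_hom _ _) = shiftF n m)).
by apply: homF_ext => i; rewrite /= inclFE symmFl shiftFE.
Qed.

Lemma symmF_shift m n w : symmF m n (shiftF m n w) = inclF n m w.
Proof.
apply: (congr1 (fun h : group_hom _ _ => h w) (_ :
  (symmF m n \o shiftF m n : group_hom _ _) = inclF n m)).
by apply: homF_ext => i; rewrite /= inclFE shiftFE symmFr.
Qed.

Definition castF m n (e : m = n) : group_hom (freeg m) (freeg n) :=
  homF (fun i => x_ (cast_ord e i)).

Arguments castF : simpl never.

Lemma castFE m n (e : m = n) i : castF e (x_ i) = x_ (cast_ord e i).
Proof. exact: homFE. Qed.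

Lemma castF_id n (e : n = n) : castF e = idfun.
Proof. by apply: homF_ext => i; rewrite castFE cast_ord_id. Qed.

Lemma eqidF m n (e : m = n) : @eqid catF m n e = castF e.
Proof. by destruct e; rewrite castF_id. Qed.

Lemma heqF m n m' n' (f : @hom catF m n) (g : @hom catF m' n')
    (em : m = m') (en : n = n') :
  (forall i, castF en (f (x_ i)) = g (x_ (cast_ord em i))) -> f ≡ g.
Proof.
destruct em, en => fg; congr (arr _); apply: homF_ext => i.
by have := fg i; rewrite castF_id cast_ord_id.
Qed.

Lemma castF_ll m n p w :
  castF (addnAV m n p) (inclF (m + n) p (inclF m n w)) = inclF m (n + p) w.
Proof.
apply: (congr1 (fun h : group_hom _ _ => h w) (_ :
  (castF _ \o (inclF (m + n) p \o inclF m n) : group_hom _ _) = inclF _ _)).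
apply: homF_ext => i; rewrite /= !inclFE castFE; congr x_; exact: val_inj.
Qed.

Lemma castF_lr m n p w :
  castF (addnAV m n p) (inclF (m + n) p (shiftF m n w))
    = shiftF m (n + p) (inclF n p w).
Proof.
apply: (congr1 (fun h : group_hom _ _ => h w) (_ :
  (castF _ \o (inclF (m + n) p \o shiftF m n) : group_hom _ _)
    = shiftF m (n + p) \o inclF n p)).
apply: homF_ext => i; rewrite /= !(inclFE, shiftFE) castFE; congr x_.
exact: val_inj.
Qed.

Lemma castF_r m n p w :
  castF (addnAV m n p) (shiftF (m + n) p w)
    = shiftF m (n + p) (shiftF n p w).
Proof.
apply: (congr1 (fun h : group_hom _ _ => h w) (_ :
  (castF _ \o shiftF (m + n) p : group_hom _ _)
    = shiftF m (n + p) \o shiftF n p)).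
apply: homF_ext => i; rewrite /= !shiftFE castFE; congr x_.
by apply: val_inj; rewrite /= addnA.
Qed.

Lemma castF_incl0 n w : castF (addn0 n) (inclF n 0 w) = w.
Proof.
apply: (congr1 (fun h : group_hom _ _ => h w) (_ :
  (castF _ \o inclF n 0 : group_hom _ _) = idfun)).
apply: homF_ext => i; rewrite /= inclFE castFE; congr x_; exact: val_inj.
Qed.

Lemma castF_shift0 n w : castF (add0n n) (shiftF 0 n w) = w.
Proof.
apply: (congr1 (fun h : group_hom _ _ => h w) (_ :
  (castF _ \o shiftF 0 n : group_hom _ _) = idfun)).
apply: homF_ext => i; rewrite /= shiftFE castFE; congr x_; exact: val_inj.
Qed.

Variant split_spec m n : 'I_(m + n) -> Type :=
| SplitL (i : 'I_m) : split_spec (lshift n i)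
| SplitR (i : 'I_n) : split_spec (rshift m i).

Lemma splitV m n (i : 'I_(m + n)) : split_spec i.
Proof. by rewrite -(splitK i); case: (split i) => j; constructor. Qed.

Lemma idFE n (w : freeg n) : (idm (n : catF) : group_hom _ _) w = w.
Proof. by []. Qed.

Lemma compFE m n p (g : @hom catF n p) (f : @hom catF m n) w :
  (g ⊚ f : group_hom _ _) w = (g : group_hom _ _) ((f : group_hom _ _) w).
Proof. by []. Qed.

Program Definition ssmF : ssmcat :=
  @SSMCat catF addn 0 tensF symmF _ _ addnAV add0n addn0 _ _ _ _ _ _ _.
Next Obligation.
move=> m n; apply: homF_ext => i; case: (splitV i) => j;
  rewrite ?compFE ?idFE.
  by rewrite tensFl idFE inclFE.
by rewrite tensFr idFE shiftFE.
Qed.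
Next Obligation.
move=> m n p m' n' p' g f g' f'; apply: homF_ext => i.
case: (splitV i) => j; rewrite compFE; first by rewrite !tensFl compFE tensF_incl.
by rewrite !tensFr compFE tensF_shift.
Qed.
Next Obligation.
move=> m n m' n' m'' n'' f g h.
apply: (heqF (em := addnAV _ _ _) (en := addnAV _ _ _)) => i.
case: (splitV i) => [j|k]; first case: (splitV j) => k.
- have -> : cast_ord (addnAV m m' m'') (lshift m'' (lshift m' k)) = lshift _ k.
    exact: val_inj.
  by rewrite !tensFl castF_ll.
- have -> : cast_ord (addnAV m m' m'') (lshift m'' (rshift m k))
      = rshift _ (lshift _ k) by exact: val_inj.
  by rewrite !(tensFl, tensFr) castF_lr.
- have -> : cast_ord (addnAV m m' m'') (rshift (m + m') k)
      = rshift _ (rshift _ k) by apply: val_inj; rewrite /= addnA.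
  by rewrite !tensFr castF_r.
Qed.
Next Obligation.
move=> m n f; apply: (heqF (em := add0n m) (en := add0n n)) => i.
case: (splitV i) => [[]//|j]; rewrite tensFr castF_shift0.
by congr (f (x_ _)); apply: val_inj.
Qed.
Next Obligation.
move=> m n f; apply: (heqF (em := addn0 m) (en := addn0 n)) => i.
case: (splitV i) => [j|[]//]; rewrite tensFl castF_incl0.
by congr (f (x_ _)); apply: val_inj.
Qed.
Next Obligation.
move=> m n m' n' f g; apply: homF_ext => i; case: (splitV i) => j;
  rewrite ?compFE ?idFE.
  by rewrite tensFl symmFl tensFr symmF_incl.
by rewrite tensFr symmFr tensFl symmF_shift.
Qed.
Next Obligation.
move=> m n; apply: homF_ext => i; case: (splitV i) => j;
  rewrite ?compFE ?idFE.
  by rewrite symmFl symmFr.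
by rewrite symmFr symmFl.
Qed.
Next Obligation.
move=> n; apply: (heqF (em := addn0 n) (en := add0n n)) => i.
case: (splitV i) => [j|[]//]; rewrite symmFl castFE; congr x_.
exact: val_inj.
Qed.
Next Obligation.
move=> m n p; rewrite eqidF.
apply: (heqF (em := esym (addnAV m n p)) (en := addnAV n p m)) => i.
case: (splitV i) => [j|j]; last case: (splitV j) => k {j}.
- have -> : cast_ord (esym (addnAV m n p)) (lshift _ j)
      = lshift _ (lshift _ j) by exact: val_inj.
  rewrite !compFE tensFl !symmFl castFE inclFE castFE.
  have -> : cast_ord (addnAV n m p) (lshift p (rshift n j))
      = rshift n (lshift p j) by exact: val_inj.
  rewrite tensFr symmFl shiftFE; congr x_.
  by apply: val_inj; rewrite /= addnA.
- have -> : cast_ord (esym (addnAV m n p)) (rshift m (lshift p k))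
      = lshift p (rshift m k) by exact: val_inj.
  rewrite !compFE tensFl !symmFr castFE inclFE castFE.
  have -> : cast_ord (addnAV n m p) (lshift p (lshift m k))
      = lshift (m + p) k by exact: val_inj.
  by rewrite tensFl inclFE; congr x_; apply: val_inj.
- have -> : cast_ord (esym (addnAV m n p)) (rshift m (rshift n k))
      = rshift (m + n) k by apply: val_inj; rewrite /= addnA.
  rewrite !compFE tensFr symmFr castFE shiftFE castFE.
  have -> : cast_ord (addnAV n m p) (rshift (n + m) k)
      = rshift n (rshift m k) by apply: val_inj; rewrite /= addnA.
  by rewrite tensFr symmFr shiftFE; congr x_; apply: val_inj.
Qed.

Definition muF : @hom catF 2 1 := @homF 2 1 (fun _ => x_ ord0).
Definition etaF : @hom catF 0 1 := @homF 0 1 (fun _ => 1%g).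
Definition deltaF : @hom catF 1 2 :=
  @homF 1 2 (fun _ => (x_ ord0 * x_ ord_max)%g).
Definition epsF : @hom catF 1 0 := @homF 1 0 (fun _ => 1%g).
Definition antiF : @hom catF 1 1 := @homF 1 1 (fun _ => (x_ ord0)^-1%g).

Lemma muFE i : (muF : group_hom _ _) (x_ i) = x_ ord0.
Proof. exact: homFE. Qed.

Lemma deltaFE i : (deltaF : group_hom _ _) (x_ i)
  = (x_ (lshift 1 ord0) * x_ (rshift 1 ord0))%g.
Proof.
by rewrite homFE; congr (x_ _ * x_ _)%g; apply: val_inj.
Qed.

Lemma epsFE i : (epsF : group_hom _ _) (x_ i) = 1%g.
Proof. exact: homFE. Qed.

Lemma antiFE i : (antiF : group_hom _ _) (x_ i) = (x_ ord0)^-1%g.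
Proof. exact: homFE. Qed.

Lemma x_ord1 (i : 'I_1) : x_ i = x_ ord0.
Proof. by congr x_; apply: val_inj; case: i => [[]]. Qed.

Lemma heqF1 m n n' (f : @hom catF m n) (g : @hom catF m n') (en : n = n') :
  (forall i, castF en (f (x_ i)) = g (x_ i)) -> f ≡ g.
Proof.
move=> fg; apply: (heqF (em := erefl) (en := en)) => i.
by rewrite cast_ord_id.
Qed.

Lemma cast_mid (e : (1 + 1 + (1 + 1) = 1 + (1 + 1) + 1)) :
  [/\ castF e (x_ (lshift 2 (lshift 1 ord0)))
        = x_ (lshift 1 (lshift 2 ord0)),
      castF e (x_ (lshift 2 (rshift 1 ord0)))
        = x_ (lshift 1 (rshift 1 (lshift 1 ord0))),
      castF e (x_ (rshift 2 (lshift 1 ord0)))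
        = x_ (lshift 1 (rshift 1 (rshift 1 ord0))) &
      castF e (x_ (rshift 2 (rshift 1 ord0))) = x_ (rshift 3 ord0)].
Proof. by split; rewrite castFE; congr x_; apply: val_inj. Qed.

Lemma cast_midV (e : 1 + (1 + 1) + 1 = 1 + 1 + (1 + 1)) :
  [/\ castF e (x_ (lshift 1 (lshift 2 ord0)))
        = x_ (lshift 2 (lshift 1 ord0)),
      castF e (x_ (lshift 1 (rshift 1 (lshift 1 ord0))))
        = x_ (lshift 2 (rshift 1 ord0)),
      castF e (x_ (lshift 1 (rshift 1 (rshift 1 ord0))))
        = x_ (rshift 2 (lshift 1 ord0)) &
      castF e (x_ (rshift 3 ord0)) = x_ (rshift 2 (rshift 1 ord0))].
Proof. by split; rewrite castFE; congr x_; apply: val_inj. Qed.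

Program Definition hopfF : hopf_monoid ssmF :=
  @HopfMonoid ssmF 1 muF etaF deltaF epsF antiF _ _ _ _ _ _ _ _ _ _ _ _.
Next Obligation.
apply: (@heqF (1 + 1 + 1) 1 (1 + (1 + 1)) 1 _ _ (addnAV 1 1 1) erefl) => i.
rewrite castF_id !compFE.
have mu_all (w : 'I_(1 + 1 + 1)) :
    (muF : group_hom _ _) (tensF muF (@idm catF 1) (x_ w)) = x_ ord0.
  by case: (splitV w) => j;
    rewrite ?tensFl ?tensFr ?muFE ?idFE ?inclFE ?shiftFE muFE.
have mu_all' (w : 'I_(1 + (1 + 1))) :
    (muF : group_hom _ _) (tensF (@idm catF 1) muF (x_ w)) = x_ ord0.
  by case: (splitV w) => j;
    rewrite ?tensFl ?tensFr ?muFE ?idFE ?inclFE ?shiftFE muFE.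
exact: etrans (mu_all _) (esym (mu_all' _)).
Qed.
Next Obligation.
apply: (@heqF (0 + 1) 1 1 1 _ _ (add0n 1) erefl) => i.
rewrite castF_id !compFE idFE; case: (splitV i) => [[]//|j].
by rewrite tensFr shiftFE [LHS]muFE x_ord1.
Qed.
Next Obligation.
apply: (@heqF (1 + 0) 1 1 1 _ _ (addn0 1) erefl) => i.
rewrite castF_id !compFE idFE; case: (splitV i) => [j|[]//].
by rewrite tensFl inclFE [LHS]muFE x_ord1.
Qed.
Next Obligation.
apply: (@heqF1 1 (1 + 1 + 1) (1 + (1 + 1))
  (@comp catF _ _ _ (tensF deltaF (@idm catF 1)) deltaF)
  (@comp catF _ _ _ (tensF (@idm catF 1) deltaF) deltaF)
  (addnAV 1 1 1)) => i.
rewrite !compFE !deltaFE !gmulfM.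
rewrite !tensFl !tensFr !idFE !deltaFE !gmulfM !(inclFE, shiftFE).
rewrite -mulgA !castFE; congr (x_ _ * (x_ _ * x_ _))%g; exact: val_inj.
Qed.
Next Obligation.
apply: (@heqF1 1 (0 + 1) 1 _ _ (add0n 1)) => i.
rewrite !compFE deltaFE !gmulfM tensFl tensFr epsFE !idFE !gmulf1 mul1g.
by rewrite shiftFE castFE [RHS]x_ord1 [LHS]x_ord1.
Qed.
Next Obligation.
apply: (@heqF1 1 (1 + 0) 1 _ _ (addn0 1)) => i.
rewrite !compFE deltaFE !gmulfM tensFl tensFr epsFE !idFE !gmulf1 mulg1.
by rewrite inclFE castFE [RHS]x_ord1 [LHS]x_ord1.
Qed.
Next Obligation. by apply: homF_ext => -[]. Qed.
Next Obligation.
apply: (@heqF1 (1 + 1) 0 (0 + 0) _ _ erefl) => i.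
rewrite castF_id compFE muFE [epsF _]epsFE /=.
by case: (splitV i) => j; rewrite (tensFl, tensFr) epsFE gmulf1.
Qed.
Next Obligation.
by apply: (@heqF 0 (1 + 1) (0 + 0) (1 + 1) _ _ erefl erefl) => -[].
Qed.
Next Obligation.
rewrite !eqidF; apply: (@homF_ext (1 + 1)) => i; rewrite !compFE muFE deltaFE.
set e := tens_mid _ _ _ _.
change ((x_ (lshift 1 ord0) * x_ (rshift 1 ord0))%g = tensF muF muF
  (castF (esym e) (tensF (tensF (@idm catF 1) (symmF 1 1)) (@idm catF 1)
    (castF e (tensF deltaF deltaF (x_ i)))))).
have [c1 c2 c3 c4] := cast_mid e; have [d1 d2 d3 d4] := cast_midV (esym e).
case: (splitV i) => j; rewrite (tensFl, tensFr) deltaFE !gmulfM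
  !(inclFE, shiftFE) ?c1 ?c2 ?c3 ?c4 !(tensFl, tensFr, symmFl, symmFr)
  !(inclFE, shiftFE, idFE) ?(tensFl, tensFr, symmFl, symmFr)
  ?(inclFE, shiftFE, idFE) ?d1 ?d2 ?d3 ?d4;
  by rewrite !(tensFl, tensFr) !muFE inclFE shiftFE.
Qed.
Next Obligation.
apply: homF_ext => i; rewrite !compFE epsFE deltaFE !gmulfM !gmulf1.
rewrite tensFl tensFr antiFE idFE !gmulfV inclFE shiftFE !muFE.
by rewrite mulgV.
Qed.
Next Obligation.
apply: homF_ext => i; rewrite !compFE epsFE deltaFE !gmulfM !gmulf1.
rewrite tensFl tensFr antiFE idFE !gmulfV inclFE shiftFE !muFE.
by rewrite mulVg.
Qed.

Program Definition comm_hopfF : comm_hopf_monoid ssmF :=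
  @CommHopfMonoid ssmF hopfF _.
Next Obligation.
by apply: (@homF_ext (1 + 1)) => i; rewrite compFE; case: (splitV i) => j;
  rewrite (symmFl, symmFr) !muFE.
Qed.

(* Main.v *)
From HB Require Import structures.
From mathcomp Require Import all_boot boolp zify.
Require Import Defs.

(* In H every morphism is a homomorphism for the commutative monoid structures
   which mu and eta induce on the tensor powers; for the antipode this holds
   because it is read off the inverse of the shear map (mu ⊗ H)(H ⊗ Delta), and
   the inverse of a monoid isomorphism is a monoid homomorphism. Hence the
   tensor product is a coproduct in H, the object n is the n-fold coproduct of
   1, and H(1, n) is a group under convolution. Freeness of F_n gives group
   homomorphisms F_n -> H(1, n), which the coproduct property assembles into a
   functor F -> H; it is inverse to T by the universal property of H on one side
   and by evaluation on generators on the other. *)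

Set Implicit Arguments.
Unset Strict Implicit.
Unset Printing Implicit Defensive.

Local Open Scope smc_scope.
#[local] Obligation Tactic := idtac.

Reserved Notation "a ∙ b" (at level 45, right associativity).
Reserved Notation "a ∥ b" (at level 40, left associativity).

(** Units of the tensor powers. Composed with [Teps_pow], they also show that no hom-set of H is
    empty. *)
Fixpoint Teta_pow n : term 0 n :=
  if n is k.+1 then Ttens Teta (Teta_pow k) else Tid 0.

Fixpoint Teps_pow n : term n 0 :=
  if n is k.+1 then Ttens Teps (Teps_pow k) else Tid 0.

(** * Diagram calculus in H *)

(* On packed arrows the strict monoidal axioms become plain equations. *)
Definition parrow := arrow ssmH.
Definition pdom (a : parrow) : nat := projT1 a.
Definition pcod (a : parrow) : nat := projT1 (projT2 a).
Definition pmor (a : parrow) : @hom ssmH (pdom a) (pcod a) :=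
  projT2 (projT2 a).
Definition pack m n (f : homH m n) : parrow := @arr ssmH m n f.

(* Composites that are not well typed get a junk value with the expected source
   and target, so that [pdom] and [pcod] of a composite need no side
   condition. *)
Definition pcomp (a b : parrow) : parrow :=
  @pack (pdom b) (pcod a) (match pcod b =P pdom a with
    | ReflectT e => pmor a ⊚ @eqid ssmH _ _ e ⊚ pmor b
    | ReflectF _ => tcls (Tcomp (Teta_pow (pcod a)) (Teps_pow (pdom b)))
    end).

Definition ptens (a b : parrow) : parrow := @arr ssmH _ _ (pmor a ⊠ pmor b).

Notation "a ∙ b" := (pcomp a b).
Notation "a ∥ b" := (ptens a b).

Definition pid (n : nat) : parrow := pack (@idm ssmH n).
Definition psym (m n : nat) : parrow := pack (@symm ssmH m n).
Definition pcls m n (t : term m n) : parrow := pack (tcls t).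

Lemma pdom_comp a b : pdom (a ∙ b) = pdom b. Proof. by []. Qed.
Lemma pcod_comp a b : pcod (a ∙ b) = pcod a. Proof. by []. Qed.
Lemma pdom_tens a b : pdom (a ∥ b) = pdom a + pdom b. Proof. by []. Qed.
Lemma pcod_tens a b : pcod (a ∥ b) = pcod a + pcod b. Proof. by []. Qed.
Lemma pdom_pack m n (f : homH m n) : pdom (pack f) = m. Proof. by []. Qed.
Lemma pcod_pack m n (f : homH m n) : pcod (pack f) = n. Proof. by []. Qed.
Lemma pdom_id n : pdom (pid n) = n. Proof. by []. Qed.
Lemma pcod_id n : pcod (pid n) = n. Proof. by []. Qed.
Lemma pdom_sym m n : pdom (psym m n) = m + n. Proof. by []. Qed.
Lemma pcod_sym m n : pcod (psym m n) = n + m. Proof. by []. Qed.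
Lemma pdom_cls m n (t : term m n) : pdom (pcls t) = m. Proof. by []. Qed.
Lemma pcod_cls m n (t : term m n) : pcod (pcls t) = n. Proof. by []. Qed.

Definition dimE := (pdom_comp, pcod_comp, pdom_tens, pcod_tens,
  pdom_pack, pcod_pack, pdom_id, pcod_id, pdom_sym, pcod_sym,
  pdom_cls, pcod_cls).

Ltac dims := rewrite ?dimE; lia.

Lemma pmorK a : pack (pmor a) = a.
Proof. by case: a => m [n f]. Qed.

Lemma pack_inj m n : injective (@pack m n).
Proof. by move=> f g; apply: heq_eq. Qed.

(** In the well-typed case the [eqid] inside [pcomp] runs along a proof of [n = n], so it is an
    identity. *)
Lemma pack_comp m n p (g : homH n p) (f : homH m n) :
  pack (compH g f) = pack g ∙ pack f.
Proof.
rewrite /pcomp; case: eqP => [e|]; last by case.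
rewrite (Prop_irrelevance e erefl); congr pack.
exact: (f_equal (@compH m n p g) (esym (@comp1m ssmH m n f))).
Qed.

Lemma pack_tens m n m' n' (f : homH m n) (g : homH m' n') :
  pack (tensH f g) = pack f ∥ pack g.
Proof. by []. Qed.

Lemma pcompA a b c : pcod c = pdom b -> pcod b = pdom a ->
  a ∙ (b ∙ c) = (a ∙ b) ∙ c.
Proof.
case: a b c => p [q h] [n' [p' g]] [m [n f]] e1 e2.
have {}e1 : n = n' by []. have {}e2 : p' = p by [].
destruct e1, e2.
rewrite -![existT _ _ _]/(pack _) -!pack_comp; congr pack.
exact: (@compA ssmH).
Qed.

Lemma pcomp1 n a : pcod a = n -> pid n ∙ a = a.
Proof.
case: a => m [n' f] e; have {}e : n' = n by []. destruct e.
rewrite -[existT _ _ _]/(pack _) -pack_comp; congr pack.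
exact: (@comp1m ssmH).
Qed.

Lemma pcompI n a : pdom a = n -> a ∙ pid n = a.
Proof.
case: a => m [n' f] e; have {}e : m = n by []. destruct e.
rewrite -[existT _ _ _]/(pack _) -pack_comp; congr pack.
exact: (@compm1 ssmH).
Qed.

Lemma ptensA a b c : a ∥ b ∥ c = a ∥ (b ∥ c).
Proof. exact: (@tensmA ssmH). Qed.

Lemma ptens1 a : pid 0 ∥ a = a.
Proof. by case: a => m [n f]; apply: (@tens1m ssmH). Qed.

Lemma ptensI a : a ∥ pid 0 = a.
Proof. by case: a => m [n f]; apply: (@tensm1 ssmH). Qed.

Lemma pid_tens m n : pid m ∥ pid n = pid (m + n).
Proof. by congr pack; apply: (@tens_id ssmH). Qed.

Lemma ptens_comp a b a' b' : pcod b = pdom a -> pcod b' = pdom a' ->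
  (a ∙ b) ∥ (a' ∙ b') = (a ∥ a') ∙ (b ∥ b').
Proof.
case: a b a' b' => n [p g] [m [n1 f]] [n' [p' g']] [m' [n1' f']] e e'.
have {}e : n1 = n by []. have {}e' : n1' = n' by []. destruct e, e'.
rewrite -![existT _ _ _]/(pack _) -!pack_comp -!pack_tens.
congr pack; exact: (@tens_comp ssmH).
Qed.

Lemma psym_nat m n m' n' a b :
    pdom a = m -> pcod a = n -> pdom b = m' -> pcod b = n' ->
  psym n n' ∙ (a ∥ b) = (b ∥ a) ∙ psym m m'.
Proof.
move=> <- <- <- <-; rewrite -(pmorK a) -(pmorK b).
move: (pmor a) (pmor b) => f g; rewrite -!pack_tens /psym.
rewrite -(@pack_comp _ _ _ _ (tensH f g)) -(@pack_comp _ _ _ (tensH g f)).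
by congr pack; apply: (@symm_nat ssmH).
Qed.

Lemma psymK m n : psym n m ∙ psym m n = pid (m + n).
Proof. by rewrite -pack_comp; congr pack; apply: (@symmK ssmH). Qed.

Lemma psymn0 (n : nat) : psym n 0 = pid n.
Proof. exact: (@symm1 ssmH). Qed.

Lemma psym0n (n : nat) : psym 0 n = pid n.
Proof. by have := psymK 0 n; rewrite psymn0 pcomp1 //; apply: addn0. Qed.

Lemma psymD m n p :
  psym m (n + p) = (pid n ∥ psym m p) ∙ (psym m n ∥ pid p).
Proof.
have := @symm_tens ssmH m n p; rewrite -[arr (symm _ _)]/(psym m (n + p)) => ->.
rewrite /pcomp; case: eqP => [e|]; last by case; apply: addnAV.
by rewrite (Prop_irrelevance e (addnAV n m p)).
Qed.

Lemma ptensDl n a b : pcod b = pdom a ->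
  pid n ∥ (a ∙ b) = (pid n ∥ a) ∙ (pid n ∥ b).
Proof. by move=> e; rewrite -ptens_comp // pcomp1. Qed.

Lemma ptensDr n a b : pcod b = pdom a ->
  (a ∙ b) ∥ pid n = (a ∥ pid n) ∙ (b ∥ pid n).
Proof. by move=> e; rewrite -ptens_comp // pcomp1. Qed.

(** The second hexagon; only [psymD] is an axiom. Both sides are inverse to [psym p (m + n)]. *)
Lemma psymDl m n p :
  psym (m + n) p = (psym m p ∥ pid n) ∙ (pid m ∥ psym n p).
Proof.
rewrite -[LHS](@pcompI (m + n + p)) //.
have <- : psym p (m + n) ∙ ((psym m p ∥ pid n) ∙ (pid m ∥ psym n p))
    = pid (m + n + p).
  rewrite psymD -pcompA; try dims.
  rewrite [X in _ ∙ X]pcompA; try dims.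
  rewrite -ptensDr // psymK pid_tens pcomp1; last dims.
  by rewrite -ptensDl // psymK pid_tens addnA.
rewrite pcompA; try dims.
rewrite psymK pcomp1 //; dims.
Qed.

Lemma ptensl a b c : pcod c = pdom b ->
  a ∥ (b ∙ c) = (a ∥ b) ∙ (pid (pdom a) ∥ c).
Proof. by move=> e; rewrite -ptens_comp // pcompI. Qed.

Lemma ptensr a b c : pcod b = pdom a ->
  (a ∙ b) ∥ c = (a ∥ c) ∙ (b ∥ pid (pdom c)).
Proof. by move=> e; rewrite -ptens_comp // pcompI. Qed.

(** Interchange law: boxes on disjoint strands slide past each other. Here [b] acts first, in
    [pexchr] [a] does. *)
Lemma pexchl m n a b : pdom a = m -> pcod b = n ->
  (a ∥ pid n) ∙ (pid m ∥ b) = a ∥ b.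
Proof. by move=> <- <-; rewrite -ptens_comp // pcompI // pcomp1. Qed.

Lemma pexchr m n a b : pcod a = m -> pdom b = n ->
  (pid m ∥ b) ∙ (a ∥ pid n) = a ∥ b.
Proof. by move=> <- <-; rewrite -ptens_comp // pcompI // pcomp1. Qed.

Lemma pid_tensA m n a : pid m ∥ (pid n ∥ a) = pid (m + n) ∥ a.
Proof. by rewrite -ptensA pid_tens. Qed.

(** Normal form of tensor words: associated to the right, with neighbouring identities merged. *)
Ltac pnorm := rewrite ?ptensA ?pid_tensA ?pid_tens.

(** Equality of diagrams up to arithmetic in the object indices. *)
Ltac peq := lazymatch goal with
  | |- @eq nat _ _ => lia
  | |- ptens _ _ = ptens _ _ => apply: f_equal2; peq
  | |- pcomp _ _ = pcomp _ _ => apply: f_equal2; peq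
  | |- pid _ = pid _ => apply: f_equal; peq
  | |- psym _ _ = psym _ _ => apply: f_equal2; peq
  | |- _ => reflexivity
  end.

(** * The Hopf axioms on packed arrows *)

Lemma pcls_comp m n p (g : term n p) (f : term m n) :
  pcls (Tcomp g f) = pcls g ∙ pcls f.
Proof. by rewrite /pcls -compHE pack_comp. Qed.
Lemma pcls_tens m n m' n' (f : term m n) (g : term m' n') :
  pcls (Ttens f g) = pcls f ∥ pcls g.
Proof. by rewrite /pcls -tensHE. Qed.
Lemma pcls_id n : pcls (Tid n) = pid n.
Proof. by []. Qed.
Lemma pcls_sym m n : pcls (Tsymm m n) = psym m n.
Proof. by []. Qed.
Lemma pcls_eqid m n (e : m = n) : pcls (Teqid e) = pid m.
Proof. by destruct e. Qed.

Definition pclsE := (pcls_comp, pcls_tens, pcls_id, pcls_sym, pcls_eqid).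

Lemma pcls_eq m n m' n' (s : term m n) (t : term m' n') :
  s ≈ t -> pcls s = pcls t.
Proof. exact: tcls_heq. Qed.

Notation pmu := (pcls Tmu).
Notation peta := (pcls Teta).
Notation pdelta := (pcls Tdelta).
Notation peps := (pcls Teps).
Notation panti := (pcls Tanti).

Lemma pmuA : pmu ∙ (pmu ∥ pid 1) = pmu ∙ (pid 1 ∥ pmu).
Proof. by have := pcls_eq E_muA; rewrite !pclsE. Qed.
Lemma pmu1 : pmu ∙ (peta ∥ pid 1) = pid 1.
Proof. by have := pcls_eq E_mu1m; rewrite !pclsE. Qed.
Lemma pmuI : pmu ∙ (pid 1 ∥ peta) = pid 1.
Proof. by have := pcls_eq E_mum1; rewrite !pclsE. Qed.
Lemma pmuC : pmu ∙ psym 1 1 = pmu.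
Proof. by have := pcls_eq E_muC; rewrite !pclsE. Qed.
Lemma pdeltaA : (pdelta ∥ pid 1) ∙ pdelta = (pid 1 ∥ pdelta) ∙ pdelta.
Proof. by have := pcls_eq E_deltaA; rewrite !pclsE. Qed.
Lemma pdelta1 : (peps ∥ pid 1) ∙ pdelta = pid 1.
Proof. by have := pcls_eq E_delta1m; rewrite !pclsE. Qed.
Lemma pdeltaI : (pid 1 ∥ peps) ∙ pdelta = pid 1.
Proof. by have := pcls_eq E_deltam1; rewrite !pclsE. Qed.
Lemma peps_eta : peps ∙ peta = pid 0.
Proof. by have := pcls_eq E_eps_eta; rewrite !pclsE. Qed.
Lemma peps_mu : peps ∙ pmu = peps ∥ peps.
Proof. by have := pcls_eq E_eps_mu; rewrite !pclsE. Qed.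
Lemma pdelta_eta : pdelta ∙ peta = peta ∥ peta.
Proof. by have := pcls_eq E_delta_eta; rewrite !pclsE. Qed.
Lemma pdelta_mu : pdelta ∙ pmu =
  (pmu ∥ pmu) ∙ (pid 1 ∥ psym 1 1 ∥ pid 1) ∙ (pdelta ∥ pdelta).
Proof.
(* Both regrouping coercions have become identities, which [pcomp1] removes. *)
have := pcls_eq E_delta_mu; rewrite !pclsE => ->; congr (_ ∙ _).
by rewrite !pcomp1.
Qed.
Lemma panti_r : pmu ∙ (pid 1 ∥ panti) ∙ pdelta = peta ∙ peps.
Proof. by have := pcls_eq E_anti_r; rewrite !pclsE. Qed.
Lemma panti_l : pmu ∙ (panti ∥ pid 1) ∙ pdelta = peta ∙ peps.
Proof. by have := pcls_eq E_anti_l; rewrite !pclsE. Qed.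

(** * Commutative monoid structure on the tensor powers *)

Lemma muH_dom n : 1 + (n + 1) + n = n.+1 + n.+1.
Proof. lia. Qed.

(** Factorwise multiplication of two blocks: the first strand of the second block crosses the last
    [k] strands of the first. [hcast] only retypes the source. *)
Fixpoint muH n : homH (n + n) n :=
  if n is k.+1 then
    @hcast ssmH _ _ (k.+1 + k.+1) k.+1 (muH_dom k) erefl
      (pmor ((pmu ∥ pack (muH k)) ∙ (pid 1 ∥ psym k 1 ∥ pid k)))
  else tcls (Tid 0).

Definition etaH n : homH 0 n := tcls (Teta_pow n).

Notation pmuN n := (pack (muH n)).
Notation petaN n := (pack (etaH n)).

Lemma pmuN0 : pmuN 0 = pid 0. Proof. by []. Qed.

Lemma pmuNS n : pmuN n.+1 = (pmu ∥ pmuN n) ∙ (pid 1 ∥ psym n 1 ∥ pid n).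
Proof.
rewrite -[RHS]pmorK; exact: (@heq_hcast ssmH _ _ _ _ (muH_dom n) erefl).
Qed.

Lemma petaN0 : petaN 0 = pid 0. Proof. by []. Qed.
Lemma petaNS n : petaN n.+1 = peta ∥ petaN n.
Proof. exact: (pcls_tens Teta (Teta_pow n)). Qed.

(** The tensor product monoid structure arises for every splitting, not only for [1 + n]. By
    induction on [m], both sides reduce to the same multiplications after the same permutation. *)
Lemma pmuND m n :
  pmuN (m + n) = (pmuN m ∥ pmuN n) ∙ (pid m ∥ psym n m ∥ pid n).
Proof.
elim: m => [|m IHm].
  by rewrite pmuN0 !ptens1 psymn0 pid_tens pcompI.
rewrite addSn !pmuNS IHm psymDl ptensl; last dims.
rewrite ptensr; last dims.
rewrite -[m.+1]add1n psymD.
rewrite !ptensDl ?ptensDr; try dims.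
rewrite -!pcompA; try dims; rewrite ?dimE ?pdom_cls; pnorm.
congr (_ ∙ _); rewrite !pcompA; try dims; congr (_ ∙ _).
(* What remains differs only in the order of two crossings on disjoint strands. *)
transitivity (pid 1 ∥ psym m 1 ∥ psym n m ∥ pid n).
  have := @pexchr (1 + 1 + m) (n + m + n) (pid 1 ∥ psym m 1) (psym n m ∥ pid n).
  pnorm => <- //; try dims; peq.
have := @pexchl (1 + m + 1) (m + n + n) (pid 1 ∥ psym m 1) (psym n m ∥ pid n).
pnorm => <- //; try dims; peq.
Qed.

Lemma petaND m n : petaN (m + n) = petaN m ∥ petaN n.
Proof.
by elim: m => [|m IHm]; rewrite ?ptens1 // addSn !petaNS IHm ptensA.
Qed.

(** * Homomorphisms of the monoid structures *)

Definition monoid_mor (f : parrow) : Prop :=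
  f ∙ pmuN (pdom f) = pmuN (pcod f) ∙ (f ∥ f)
  /\ f ∙ petaN (pdom f) = petaN (pcod f).

Lemma monoid_mor_id n : monoid_mor (pid n).
Proof. by split; rewrite ?pid_tens ?pcompI ?pcomp1. Qed.

Lemma monoid_mor_comp g f : pcod f = pdom g ->
  monoid_mor g -> monoid_mor f -> monoid_mor (g ∙ f).
Proof.
move=> e [gM g1] [fM f1]; split.
  rewrite !dimE -pcompA ?fM; try dims.
  rewrite pcompA; try dims.
  rewrite e gM -pcompA; try dims.
  by rewrite ptens_comp.
rewrite !dimE -pcompA ?f1; try dims.
by rewrite e g1.
Qed.

Lemma monoid_mor_tens f g :
  monoid_mor f -> monoid_mor g -> monoid_mor (f ∥ g).
Proof.
move=> [fM f1] [gM g1]; split; last by rewrite !petaND -ptens_comp // f1 g1.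
rewrite !pmuND pcompA; try dims.
rewrite -ptens_comp // fM gM ptens_comp; try dims.
rewrite -!pcompA; try dims; congr (_ ∙ _).
(* Naturality carries [f] and [g] across the middle crossing. *)
have := @psym_nat _ _ _ _ g f erefl erefl erefl erefl => fg.
transitivity (f ∥ ((f ∥ g) ∙ psym (pdom g) (pdom f)) ∥ g).
  rewrite ptensl; last dims.
  rewrite ptensr; last dims.
  by pnorm.
rewrite -fg -[f in LHS](@pcomp1 (pcod f)) // -[g in LHS](@pcomp1 (pcod g)) //.
rewrite !ptens_comp; try dims.
by rewrite !pcomp1 //; pnorm; rewrite pcomp1 //; pnorm.
Qed.

(** The permutation identity behind [monoid_mor_sym]: once the hexagons expand the large crossing,
    [psym n m] cancels against its inverse. *)
Lemma psym_double m n : psym (m + m) (n + n) ∙ (pid m ∥ psym n m ∥ pid n)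
  = (pid n ∥ psym m n ∥ pid m) ∙ (psym m n ∥ psym m n).
Proof.
rewrite psymD !psymDl ptensDl ?ptensDr; try dims.
rewrite -!pcompA; try dims.
pnorm.
have -> : (pid m ∥ (psym m n ∥ pid n)) ∙ (pid m ∥ (psym n m ∥ pid n))
    = pid (m + n + m + n).
  rewrite -ptensDl ?dimE // -ptensDr ?dimE // psymK; pnorm; peq.
rewrite pcompI; last dims.
congr (_ ∙ _).
exact: pexchr.
Qed.

Lemma monoid_mor_sym m n : monoid_mor (psym m n).
Proof.
split; rewrite !dimE.
  rewrite !pmuND pcompA; try dims.
  rewrite (@psym_nat (m + m) m (n + n) n) // -pcompA; try dims.
  by rewrite psym_double pcompA; try dims.
rewrite !petaND (@psym_nat 0 m 0 n) // psymn0 pcompI //.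
Qed.

Lemma monoid_mor_inv f g : f ∙ g = pid (pdom g) -> g ∙ f = pid (pdom f) ->
  monoid_mor f -> monoid_mor g.
Proof.
move=> fg gf [fM f1].
have e1 : pcod f = pdom g by rewrite -(pcod_comp f g) fg.
have e2 : pcod g = pdom f by rewrite -(pcod_comp g f) gf.
split.
  rewrite -[LHS](@pcompI (pdom g + pdom g)) // -pid_tens -fg ptens_comp //.
  rewrite pcompA; try dims.
  rewrite -[(g ∙ _) ∙ _]pcompA -?e1 -?fM; try dims.
  rewrite [g ∙ _]pcompA; try dims.
  by rewrite gf e2 pcomp1.
by rewrite -e1 -f1 pcompA // gf e2 pcomp1.
Qed.

Lemma pmuN1 : pmuN 1 = pmu.
Proof. by rewrite pmuNS pmuN0 psym0n !ptensI pid_tens pcompI. Qed.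

Lemma petaN1 : petaN 1 = peta.
Proof. by rewrite petaNS petaN0 ptensI. Qed.

Lemma pmuN2 : pmuN (1 + 1) = (pmu ∥ pmu) ∙ (pid 1 ∥ psym 1 1 ∥ pid 1).
Proof. by rewrite pmuND pmuN1. Qed.

Lemma petaN2 : petaN (1 + 1) = peta ∥ peta.
Proof. by rewrite petaND petaN1. Qed.

Lemma pmu_eta2 : pmu ∙ (peta ∥ peta) = peta.
Proof.
rewrite -(@pexchl 0 1 peta peta) // pcompA; try dims.
by rewrite pmu1 ptens1 pcomp1.
Qed.

(** Rebracketing that multiplies the two middle factors first, where [monoid_mor_mu] needs
    commutativity. *)
Lemma pmuA2 : pmu ∙ (pmu ∥ pmu) = pmu ∙ (pid 1 ∥ pmu) ∙ (pid 1 ∥ pmu ∥ pid 1).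
Proof.
rewrite -(@pexchl (1 + 1) 1 pmu pmu) // pcompA; try dims.
rewrite pmuA -pcompA; try dims.
rewrite -pid_tens ptensA -ptensDl; last dims.
by rewrite -pmuA ptensDl // ptensA.
Qed.

Lemma monoid_mor_mu : monoid_mor pmu.
Proof.
split; rewrite pdom_cls pcod_cls; last first.
  by rewrite petaN2 petaN1 pmu_eta2.
rewrite pmuN2 pmuN1 pcompA; try dims.
rewrite pmuA2 -!pcompA; try dims.
rewrite -ptensDr; last dims.
(* Commutativity absorbs the crossing of the middle factors. *)
by rewrite -ptensDl // pmuC.
Qed.

(** For [pdelta], as for [peps], this is the bialgebra axioms. *)
Lemma monoid_mor_delta : monoid_mor pdelta.
Proof.
split; rewrite pdom_cls pcod_cls.
  by rewrite pmuN2 pmuN1 pdelta_mu pcompA; try dims.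
by rewrite petaN1 petaN2 pdelta_eta.
Qed.

Lemma monoid_mor_eta : monoid_mor peta.
Proof.
by split; rewrite pdom_cls pcod_cls ?pmuN1 ?pmu_eta2 ?petaN1 pcompI.
Qed.

Lemma monoid_mor_eps : monoid_mor peps.
Proof.
split; rewrite pdom_cls pcod_cls.
  by rewrite pmuN1 peps_mu pcomp1.
by rewrite petaN1 peps_eta.
Qed.

(* Convolution turns into composition of shear maps, so that the shear maps of
   the identity and of the antipode are mutually inverse. *)
Definition pshear (a : parrow) :=
  (pmu ∥ pid 1) ∙ (pid 1 ∥ ((a ∥ pid 1) ∙ pdelta)).

(** In Sweedler notation [pshear b] sends (x, y) to (x b(y1), y2), and [pshear a] then gives (x
    b(y1) a(y2), y3); hence the reversed order of [a] and [b]. *)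
Lemma pshear_comp a b :
    pdom a = 1 -> pcod a = 1 -> pdom b = 1 -> pcod b = 1 ->
  pshear a ∙ pshear b = pshear (pmu ∙ (b ∥ a) ∙ pdelta).
Proof.
move=> a1 a2 b1 b2; rewrite /pshear.
set X := (a ∥ pid 1) ∙ pdelta; set Y := (b ∥ pid 1) ∙ pdelta.
(* [X] acts on a strand that the earlier multiplication leaves alone, so all multiplications can be
   gathered on the left. *)
have XE : (pid 1 ∥ X) ∙ (pmu ∥ pid 1)
    = (pmu ∥ pid (1 + 1)) ∙ (pid (1 + 1) ∥ X).
  by rewrite pexchr // pexchl //; rewrite !dimE a2.
have muE : (pmu ∥ pid 1) ∙ (pmu ∥ pid (1 + 1))
    = (pmu ∥ pid 1) ∙ (pid 1 ∥ (pmu ∥ pid 1)).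
  by rewrite -[pid (1 + 1)]pid_tens -ptensA -ptensDr // pmuA ptensDr // ptensA.
have dX : pdom X = 1 by []. have cX : pcod X = 1 + 1 by rewrite !dimE a2.
have cY : pcod Y = 1 + 1 by rewrite !dimE b2.
rewrite -pcompA; try dims.
rewrite [(pid 1 ∥ X) ∙ _]pcompA; try dims.
rewrite XE -pcompA; try dims.
rewrite pcompA; try dims.
rewrite muE -pcompA; try dims.
congr (_ ∙ _); rewrite -(pid_tens 1 1) ptensA -!ptensDl; try dims.
congr (_ ∥ _); rewrite !ptensDr; try dims.
rewrite -!pcompA; try dims.
congr (_ ∙ _); rewrite pdeltaA /X /Y.
rewrite ptensDl ?ptensA -?pcompA; try dims.
rewrite [(pid 1 ∥ pdelta) ∙ _]pcompA; try dims.
rewrite pexchr // -(@pexchl 1 (1 + 1) b pdelta) // -pcompA; try dims.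
rewrite pcompA; try dims.
by rewrite pexchr // !dimE a1.
Qed.

Lemma pshear1 : pshear (peta ∙ peps) = pid (1 + 1).
Proof.
rewrite /pshear ptensDr // -pcompA; try dims.
rewrite pdelta1 pcompI // -ptensA -ptensDr; last dims.
by rewrite pmuI pid_tens.
Qed.

(** The antipode is read off its shear map: (1, y) goes to (S(y1), y2), and the counit removes
    y2. *)
Lemma panti_shear :
  panti = (pid 1 ∥ peps) ∙ pshear panti ∙ (peta ∥ pid 1).
Proof.
rewrite /pshear -pcompA; try dims.
rewrite (@pexchr 1 1) //.
rewrite -(@pexchl 0 (1 + 1) peta) ?ptens1; try dims.
rewrite [(pmu ∥ _) ∙ _]pcompA; try dims.
rewrite -pid_tens -ptensA -ptensDr; last dims.
rewrite pmu1 pid_tens pcomp1; last dims.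
rewrite pcompA; try dims.
rewrite (@pexchr 1 1) // -(@pexchl 1 0) // ptensI -pcompA; try dims.
by rewrite pdeltaI pcompI.
Qed.

Lemma monoid_mor_anti : monoid_mor panti.
Proof.
have M1 : monoid_mor (pshear (pid 1)).
  apply: monoid_mor_comp; first dims.
    exact/monoid_mor_tens/monoid_mor_id/monoid_mor_mu.
  apply: monoid_mor_tens; first exact: monoid_mor_id.
  rewrite pid_tens pcomp1 //; exact: monoid_mor_delta.
have MS : monoid_mor (pshear panti).
  apply: monoid_mor_inv M1.
    by rewrite pshear_comp // panti_l pshear1.
  by rewrite pshear_comp // panti_r pshear1.
rewrite panti_shear; apply: monoid_mor_comp; first dims.
  apply: monoid_mor_tens; first exact: monoid_mor_id.
  exact: monoid_mor_eps.
apply: monoid_mor_comp => //.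
apply: monoid_mor_tens; first exact: monoid_mor_eta.
exact: monoid_mor_id.
Qed.

Lemma monoid_mor_cls m n (t : term m n) : monoid_mor (pcls t).
Proof.
elim: t => {m n}.
- by move=> n; rewrite pclsE; apply: monoid_mor_id.
- by move=> m n p g IHg f IHf; rewrite pclsE; apply: monoid_mor_comp.
- by move=> m n m' n' f IHf g IHg; rewrite pclsE; apply: monoid_mor_tens.
- by move=> m n; rewrite pclsE; apply: monoid_mor_sym.
- exact: monoid_mor_mu.
- exact: monoid_mor_eta.
- exact: monoid_mor_delta.
- exact: monoid_mor_eps.
- exact: monoid_mor_anti.
Qed.

Lemma monoid_mor_pack m n (f : homH m n) : monoid_mor (pack f).
Proof. rewrite -[f]treprK; exact: monoid_mor_cls. Qed.

(** * The tensor product as a coproduct *)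

Lemma pmuN_l n : pmuN n ∙ (petaN n ∥ pid n) = pid n.
Proof.
elim: n => [|n IHn]; first by rewrite ptens1 pcomp1.
rewrite pmuNS petaNS -[in pid n.+1]add1n -!pid_tens -pcompA; try dims.
(* By naturality a crossing with units becomes [psym 0 1], an identity. *)
have P1 : (pid 1 ∥ psym n 1 ∥ pid n) ∙ (peta ∥ petaN n ∥ (pid 1 ∥ pid n))
    = peta ∥ pid 1 ∥ (petaN n ∥ pid n).
  transitivity ((pid 1 ∙ peta) ∥ (psym n 1 ∙ (petaN n ∥ pid 1))
     ∥ (pid n ∙ pid n)).
    rewrite !ptens_comp; try dims.
    by pnorm.
  rewrite (@psym_nat 0 n 1 1) // psym0n !pcomp1 // pcompI //.
  by pnorm.
by rewrite P1 -ptens_comp // pmu1 IHn.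
Qed.

Lemma pmuN_r n : pmuN n ∙ (pid n ∥ petaN n) = pid n.
Proof.
elim: n => [|n IHn]; first by rewrite ptens1 pcomp1.
rewrite pmuNS petaNS -[in pid n.+1]add1n -!pid_tens -pcompA; try dims.
have P1 : (pid 1 ∥ psym n 1 ∥ pid n) ∙ (pid 1 ∥ pid n ∥ (peta ∥ petaN n))
    = pid 1 ∥ peta ∥ (pid n ∥ petaN n).
  transitivity ((pid 1 ∙ pid 1) ∥ (psym n 1 ∙ (pid n ∥ peta))
     ∥ (pid n ∙ petaN n)).
    rewrite !ptens_comp; try dims.
    by rewrite !ptensA.
  rewrite (@psym_nat n n 0 1) // psymn0 !pcomp1 // pcompI //.
  by rewrite !ptensA.
by rewrite P1 -ptens_comp // pmuI IHn.
Qed.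

(* Eckmann-Hilton: [muH n] is itself a monoid homomorphism. *)
Lemma pmuNA n : pmuN n ∙ (pmuN n ∥ pid n) = pmuN n ∙ (pid n ∥ pmuN n).
Proof.
have [MM _] := monoid_mor_pack (muH n).
move: MM; rewrite pdom_pack pcod_pack pmuND => MM.
set Z := pid n ∥ petaN n ∥ pid (n + n).
(* A unit is inserted in the second of four slots, so that [MM] applies; the middle crossing then
   moves it to the third slot, which yields the other bracketing. *)
have -> : pid n ∥ pmuN n = (pmuN n ∥ pmuN n) ∙ Z.
  by rewrite -ptens_comp // pmuN_r pcompI.
rewrite pcompA -?MM -?pcompA /Z; try dims; congr (_ ∙ _).
transitivity ((pmuN n ∥ pmuN n) ∙ (pid n ∥ pid n ∥ (petaN n ∥ pid n))).
  by rewrite -ptens_comp // pmuN_l pid_tens pcompI.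
congr (_ ∙ _).
transitivity ((pid n ∙ pid n) ∥ (psym n n ∙ (petaN n ∥ pid n))
     ∥ (pid n ∙ pid n)).
  by rewrite (@psym_nat 0 n n n) // psym0n !pcomp1 // pcompI; [pnorm | dims].
rewrite !ptens_comp; try dims.
by pnorm.
Qed.

Definition idH n : homH n n := tcls (Tid n).
Definition symH m n : homH (m + n) (n + m) := tcls (Tsymm m n).
Definition inrH m n : homH n (m + n) := tensH (etaH m) (idH n).
(** A symmetry is used because [tensH (idH m) (etaH n)] has source [m + 0], which is not convertible
    to [m]; [pack_inl] recovers that form. *)
Definition inlH m n : homH m (m + n) := compH (symH n m) (inrH n m).
Definition copairH m n p (f : homH m p) (g : homH n p) : homH (m + n) p :=
  compH (muH p) (tensH f g).

Lemma pack_inr m n : pack (inrH m n) = petaN m ∥ pid n.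
Proof. exact: (pack_tens (etaH m) (idH n)). Qed.

Lemma pack_inl m n : pack (inlH m n) = pid m ∥ petaN n.
Proof.
rewrite pack_comp pack_inr -[pack (symH n m)]/(psym n m) (@psym_nat 0 n m m) //.
by rewrite psym0n pcompI //; dims.
Qed.

Lemma pack_copair m n p (f : homH m p) (g : homH n p) :
  pack (copairH f g) = pmuN p ∙ (pack f ∥ pack g).
Proof. exact: pack_comp. Qed.

Lemma compHA m n p q (h : homH p q) (g : homH n p) (f : homH m n) :
  compH h (compH g f) = compH (compH h g) f.
Proof. exact: (@compA ssmH). Qed.

Lemma comp1H m n (f : homH m n) : compH (idH n) f = f.
Proof. exact: (@comp1m ssmH). Qed.

Lemma compH1 m n (f : homH m n) : compH f (idH m) = f.
Proof. exact: (@compm1 ssmH). Qed.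

(** At [m = 0] the unit is the identity, so this makes 0 initial. *)
Lemma compH_eta m n (f : homH m n) : compH f (etaH m) = etaH n.
Proof.
by apply: pack_inj; rewrite pack_comp; case: (monoid_mor_pack f).
Qed.

Lemma compH_copair m n p q (h : homH p q) (f : homH m p) (g : homH n p) :
  compH h (copairH f g) = copairH (compH h f) (compH h g).
Proof.
apply: pack_inj; rewrite pack_comp !pack_copair !pack_comp.
rewrite ptens_comp // pcompA // pcompA //.
by have [-> _] := monoid_mor_pack h.
Qed.

Lemma copairH_inl m n p (f : homH m p) (g : homH n p) :
  compH (copairH f g) (inlH m n) = f.
Proof.
apply: pack_inj; rewrite pack_comp pack_copair pack_inl -pcompA; try dims.
have [_ ge] := monoid_mor_pack g.
rewrite -ptens_comp // ge pcompI // -(@pexchr p 0) // ptensI.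
by rewrite pcompA ?pmuN_r ?pcomp1 //; dims.
Qed.

Lemma copairH_inr m n p (f : homH m p) (g : homH n p) :
  compH (copairH f g) (inrH m n) = g.
Proof.
apply: pack_inj; rewrite pack_comp pack_copair pack_inr -pcompA; try dims.
have [_ fe] := monoid_mor_pack f.
rewrite -ptens_comp // fe pcompI // -(@pexchl 0 p) // ptens1.
by rewrite pcompA ?pmuN_l ?pcomp1 //; dims.
Qed.

(** Together with [compH_copair] this yields the uniqueness half of the universal property,
    [copairH_ext]. *)
Lemma copairH_id m n : copairH (inlH m n) (inrH m n) = idH (m + n).
Proof.
apply: pack_inj; rewrite pack_copair pack_inl pack_inr pmuND -pcompA; try dims.
have -> : (pid m ∥ psym n m ∥ pid n) ∙ (pid m ∥ petaN n ∥ (petaN m ∥ pid n))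
    = (pid m ∥ petaN m) ∥ (petaN n ∥ pid n).
  transitivity ((pid m ∙ pid m) ∥ (psym n m ∙ (petaN n ∥ petaN m))
     ∥ (pid n ∙ pid n)).
    rewrite !ptens_comp; try dims.
    by rewrite !ptensA.
  by rewrite (@psym_nat 0 n 0 m) // psym0n !pcomp1 // pcompI // !ptensA.
by rewrite -ptens_comp // pmuN_l pmuN_r pid_tens.
Qed.

Lemma copairH_ext m n p (f g : homH (m + n) p) :
  compH f (inlH m n) = compH g (inlH m n) ->
  compH f (inrH m n) = compH g (inrH m n) -> f = g.
Proof.
move=> fgl fgr.
by rewrite -[f]compH1 -[g]compH1 -copairH_id !compH_copair fgl fgr.
Qed.

(** The injections of the [m]-fold coproduct. Since ['I_0] is empty, [Teps] is a mere
    placeholder. *)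
Fixpoint iotaH m : 'I_m -> homH 1 m :=
  if m is k.+1 then fun i : 'I_(1 + k) =>
    match split i with
    | inl _ => inlH 1 k
    | inr j => compH (inrH 1 k) (iotaH j)
    end
  else fun _ => tcls Teps.

Lemma iotaHl m i : iotaH (lshift m i : 'I_(1 + m)) = inlH 1 m.
Proof. by rewrite /= (unsplitK (inl i)). Qed.

Lemma iotaHr m i : iotaH (rshift 1 i : 'I_(1 + m)) = compH (inrH 1 m) (iotaH i).
Proof. by rewrite /= (unsplitK (inr i)). Qed.

Lemma homH_ext m n (f g : homH m n) :
  (forall i, compH f (iotaH i) = compH g (iotaH i)) -> f = g.
Proof.
elim: m f g => [|m IHm] f g fg.
  by rewrite -[f]compH1 -[g]compH1 -[idH 0]/(etaH 0) !compH_eta.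
apply: (@copairH_ext 1).
  by rewrite -(iotaHl m ord0) fg.
by apply: IHm => i; rewrite -!compHA -iotaHr.
Qed.

Fixpoint cotuple m n : ('I_m -> homH 1 n) -> homH m n :=
  if m is k.+1 then fun c : 'I_(1 + k) -> homH 1 n =>
    copairH (c (lshift k ord0)) (cotuple (fun j => c (rshift 1 j)))
  else fun _ => etaH n.

Lemma cotupleE m n (c : 'I_m -> homH 1 n) i : compH (cotuple c) (iotaH i) = c i.
Proof.
elim: m c i => [|m IHm] c i; first by case: i.
case: (splitV (i : 'I_(1 + m))) => j.
  by rewrite iotaHl copairH_inl [j]ord1.
by rewrite iotaHr compHA [compH _ (inrH 1 m)]copairH_inr IHm.
Qed.

(** This and the next two lemmas match the injections across the regrouping of [1 + m + n], for the
    inductions in [inlH_iota] and [inrH_iota]. *)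
Lemma inlH_inl m n :
  compH (inlH (1 + m) n) (inlH 1 m) = inlH 1 (m + n) :> homH 1 (1 + (m + n)).
Proof.
apply: pack_inj; rewrite pack_comp !pack_inl petaND -ptensA.
by rewrite -(@pexchr (1 + m) 0 (pid 1 ∥ petaN m)) // ptensI.
Qed.

Lemma inlH_inr m n : compH (inlH (1 + m) n) (inrH 1 m)
  = compH (inrH 1 (m + n)) (inlH m n) :> homH m (1 + (m + n)).
Proof.
apply: pack_inj; rewrite pack_comp (pack_comp (inlH (1 + m) n)).
rewrite !pack_inl !pack_inr petaN1.
transitivity (peta ∥ pid m ∥ petaN n).
  rewrite -(@pexchr (1 + m) 0 (peta ∥ pid m)) ?ptensI //.
rewrite ptensA -(@pexchl 0 (m + n) peta) ?ptens1 //.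
Qed.

Lemma inrHD m n : inrH (1 + m) n = compH (inrH 1 (m + n)) (inrH m n)
  :> homH n (1 + (m + n)).
Proof.
apply: pack_inj; rewrite pack_comp !pack_inr (pack_inr (1 + m)) petaND ptensA.
by rewrite -(@pexchl 0 (m + n) (petaN 1)) ?ptens1.
Qed.

Lemma inlH_iota m n (i : 'I_m) :
  compH (inlH m n) (iotaH i) = iotaH (lshift n i).
Proof.
elim: m i => [|m IHm] i; first by case: i.
case: (splitV (i : 'I_(1 + m))) => j.
  have -> : lshift n (lshift m j : 'I_(1 + m)) = lshift (m + n) j.
    exact: val_inj.
  by rewrite !iotaHl inlH_inl.
have -> : lshift n (rshift 1 j : 'I_(1 + m)) = rshift 1 (lshift n j).
  exact: val_inj.
by rewrite !iotaHr compHA inlH_inr -compHA IHm.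
Qed.

Lemma inrH_iota m n (i : 'I_n) :
  compH (inrH m n) (iotaH i) = iotaH (rshift m i).
Proof.
elim: m => [|m IHm].
  have -> : rshift 0 i = i by exact: val_inj.
  have -> : inrH 0 n = idH n; last exact: comp1H.
  by apply: pack_inj; rewrite pack_inr ptens1.
have -> : rshift m.+1 i = rshift 1 (rshift m i) :> 'I_(1 + (m + n)).
  exact: val_inj.
by rewrite iotaHr inrHD -compHA IHm.
Qed.

(** * The convolution group H(1, n) and the functor from F to H *)

(** A separate name to carry the group instance; the underlying equality and choice structures are
    classical. *)
Definition cogroup n := homH 1 n.

HB.instance Definition _ n := gen_eqMixin (cogroup n).
HB.instance Definition _ n := gen_choiceMixin (cogroup n).

Section Cogroup.
Variable n : nat.
Implicit Types f g h : cogroup n.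

Definition mulH f g : cogroup n := compH (copairH f g) (tcls Tdelta).
Definition oneH : cogroup n := compH (etaH n) (tcls Teps).
Definition invH f : cogroup n := compH f (tcls Tanti).

Lemma pack_mul f g : pack (mulH f g) = pmuN n ∙ (pack f ∥ pack g) ∙ pdelta.
Proof. by rewrite pack_comp pack_copair pcompA. Qed.

Lemma pack_one : pack oneH = petaN n ∙ peps.
Proof. exact: pack_comp. Qed.

Fact mulHA : associative mulH.
Proof.
move=> f g h; apply: pack_inj; rewrite !pack_mul.
have -> : pack f ∥ (pmuN n ∙ (pack g ∥ pack h) ∙ pdelta)
    = (pid n ∥ pmuN n) ∙ (pack f ∥ (pack g ∥ pack h)) ∙ (pid 1 ∥ pdelta).
  by rewrite -!ptens_comp // pcomp1 // pcompI.
have -> : (pmuN n ∙ (pack f ∥ pack g) ∙ pdelta) ∥ pack h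
    = (pmuN n ∥ pid n) ∙ (pack f ∥ (pack g ∥ pack h)) ∙ (pdelta ∥ pid 1).
  by rewrite -ptensA -!ptens_comp // pcomp1 // pcompI.
rewrite -!pcompA; try dims.
rewrite pdeltaA [LHS]pcompA; try dims.
by rewrite -pmuNA -pcompA; try dims.
Qed.

Fact mul1H : left_id oneH mulH.
Proof.
move=> f; apply: pack_inj; rewrite pack_mul pack_one.
rewrite -[pack f in LHS](@pcompI 1) // ptens_comp // -pcompA; try dims.
rewrite pdelta1 pcompI // -(@pexchl 0 n) // ptens1 pcompA; try dims.
by rewrite pmuN_l pcomp1.
Qed.

Fact mulH1 : right_id oneH mulH.
Proof.
move=> f; apply: pack_inj; rewrite pack_mul pack_one.
rewrite -[pack f in LHS](@pcompI 1) // ptens_comp // -pcompA; try dims.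
rewrite pdeltaI pcompI // -(@pexchr n 0) // ptensI pcompA; try dims.
by rewrite pmuN_r pcomp1.
Qed.

(** As a monoid homomorphism, [f] can be pulled out of the convolution; the antipode axiom remains,
    and [f] preserves the unit. *)
Fact mulVH : left_inverse oneH invH mulH.
Proof.
move=> f; apply: pack_inj; rewrite pack_mul pack_one pack_comp.
rewrite -[pack f in X in _ ∥ X](@pcompI 1) // ptens_comp // -pcompA; try dims.
rewrite pcompA; try dims.
have [<- <-] := monoid_mor_pack f; rewrite pmuN1 petaN1 -!pcompA; try dims.
by rewrite panti_l.
Qed.

Fact mulHV : right_inverse oneH invH mulH.
Proof.
move=> f; apply: pack_inj; rewrite pack_mul pack_one pack_comp.
rewrite -[pack f in X in X ∥ _](@pcompI 1) // ptens_comp // -pcompA; try dims.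
rewrite pcompA; try dims.
have [<- <-] := monoid_mor_pack f; rewrite pmuN1 petaN1 -!pcompA; try dims.
by rewrite panti_r.
Qed.

HB.instance Definition _ := isGroup.Build (cogroup n)
  mulHA mul1H mulH1 mulVH mulHV.

End Cogroup.

Lemma compH_mul m n (h : homH m n) (f g : cogroup m) :
  compH h (f * g)%g = ((compH h f : cogroup n) * (compH h g : cogroup n))%g.
Proof. by rewrite compHA compH_copair. Qed.

Lemma compH_one m n (h : homH m n) :
  compH h (1%g : cogroup m) = (1%g : cogroup n).
Proof. by rewrite compHA compH_eta. Qed.

Section CompGroupHom.
Variables (m n : nat) (h : homH m n).

Definition compH_fun (f : cogroup m) : cogroup n := compH h f.

Fact compH_monoid : monoid_morphism compH_fun.
Proof. by split=> [|f g]; [apply: compH_one | apply: compH_mul]. Qed.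

HB.instance Definition _ :=
  isUMagmaMorphism.Build (cogroup m) (cogroup n) compH_fun compH_monoid.

Definition compH_hom : group_hom (cogroup m) (cogroup n) := compH_fun.

End CompGroupHom.

(** * From words to morphisms of H *)

Definition wordH n : group_hom (freeg n) (cogroup n) :=
  @flift 'I_n (cogroup n) (fun i => iotaH i).

Lemma wordH_gen n i : wordH n (x_ i) = iotaH i.
Proof. exact: (@flift_gen 'I_n (cogroup n)). Qed.

Definition liftH m n (f : group_hom (freeg m) (freeg n)) : homH m n :=
  cotuple (fun i => wordH n (f (x_ i))).

Lemma liftH_iota m n (f : group_hom (freeg m) (freeg n)) i :
  compH (liftH f) (iotaH i) = wordH n (f (x_ i)).
Proof. exact: cotupleE. Qed.

(** Both sides are group homomorphisms in [w], so generators suffice. Functoriality of [liftH] rests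
    on this. *)
Lemma liftH_word m n (f : group_hom (freeg m) (freeg n)) w :
  compH (liftH f) (wordH m w) = wordH n (f w).
Proof.
apply: (congr1 (fun h : group_hom _ _ => h w) (_ :
  (compH_hom (liftH f) \o wordH m : group_hom _ _) = wordH n \o f)).
by apply: homF_ext => i; rewrite /= wordH_gen; apply: liftH_iota.
Qed.

(** Holds because [f'] preserves units; with [tensH_inr] it identifies the tensor product of
    morphisms with their coproduct. *)
Lemma tensH_inl m n m' n' (f : homH m n) (f' : homH m' n') :
  compH (tensH f f') (inlH m m') = compH (inlH n n') f.
Proof.
apply: pack_inj; rewrite (pack_comp (inlH n n')) pack_comp pack_tens !pack_inl.
have [_ fe] := monoid_mor_pack f'.
by rewrite -ptens_comp // fe pcompI // -(@pexchr n 0) // ptensI.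
Qed.

Lemma tensH_inr m n m' n' (f : homH m n) (f' : homH m' n') :
  compH (tensH f f') (inrH m m') = compH (inrH n n') f'.
Proof.
apply: pack_inj; rewrite !pack_comp pack_tens !pack_inr.
have [_ fe] := monoid_mor_pack f.
by rewrite -ptens_comp // fe pcompI // -(@pexchl 0 n') // ptens1.
Qed.

Lemma symH_inr m n : compH (symH m n) (inrH m n) = inlH n m.
Proof. by []. Qed.

Lemma symH_inl m n : compH (symH m n) (inlH m n) = inrH n m.
Proof.
rewrite compHA; have -> : compH (symH m n) (symH n m) = idH (n + m).
  exact: (@symmK ssmH n m).
exact: comp1H.
Qed.

Lemma wordH_incl m n w :
  wordH (m + n) (inclF m n w) = compH (inlH m n) (wordH m w).
Proof.
apply: (congr1 (fun h : group_hom _ _ => h w) (_ :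
  (wordH (m + n) \o inclF m n : group_hom _ _)
    = compH_hom (inlH m n) \o wordH m)).
apply: homF_ext => i; rewrite /= inclFE !wordH_gen.
by apply: esym; apply: inlH_iota.
Qed.

Lemma wordH_shift m n w :
  wordH (m + n) (shiftF m n w) = compH (inrH m n) (wordH n w).
Proof.
apply: (congr1 (fun h : group_hom _ _ => h w) (_ :
  (wordH (m + n) \o shiftF m n : group_hom _ _)
    = compH_hom (inrH m n) \o wordH n)).
apply: homF_ext => i; rewrite /= shiftFE !wordH_gen.
by apply: esym; apply: inrH_iota.
Qed.

Lemma liftH_id n : liftH (idfun : group_hom (freeg n) (freeg n)) = idH n.
Proof. by apply: homH_ext => i; rewrite liftH_iota /= wordH_gen comp1H. Qed.

Lemma liftH_comp m n p (g : group_hom (freeg n) (freeg p))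
    (f : group_hom (freeg m) (freeg n)) :
  liftH (g \o f : group_hom _ _) = compH (liftH g) (liftH f).
Proof.
by apply: homH_ext => i; rewrite -compHA !liftH_iota liftH_word.
Qed.

Lemma liftH_tens m n m' n' (f : group_hom (freeg m) (freeg n))
    (f' : group_hom (freeg m') (freeg n')) :
  liftH (tensF f f') = tensH (liftH f) (liftH f').
Proof.
apply: homH_ext => i; rewrite liftH_iota; case: (splitV i) => j.
  by rewrite tensFl wordH_incl -inlH_iota compHA tensH_inl -compHA liftH_iota.
by rewrite tensFr wordH_shift -inrH_iota compHA tensH_inr -compHA liftH_iota.
Qed.

Lemma liftH_sym m n : liftH (symmF m n) = symH m n.
Proof.
apply: homH_ext => i; rewrite liftH_iota; case: (splitV i) => j.
  by rewrite symmFl wordH_gen -inlH_iota compHA symH_inl inrH_iota.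
by rewrite symmFr wordH_gen -inrH_iota compHA symH_inr inlH_iota.
Qed.

Lemma iotaH1 (i : 'I_1) : iotaH i = idH 1.
Proof.
rewrite (ord1 i) -[ord0](_ : lshift 0 (ord0 : 'I_1) = ord0).
  by rewrite iotaHl; apply: pack_inj; rewrite pack_inl ptensI.
exact: val_inj.
Qed.

Lemma iotaH2l : iotaH (lshift 1 ord0 : 'I_(1 + 1)) = inlH 1 1.
Proof. exact: iotaHl. Qed.

Lemma iotaH2r : iotaH (rshift 1 ord0 : 'I_(1 + 1)) = inrH 1 1.
Proof. by rewrite iotaHr iotaH1 compH1. Qed.

(** The multiplication is the codiagonal, so [liftH_mu] can be checked on the two injections. *)
Lemma muH_copair n : muH n = copairH (idH n) (idH n).
Proof.
apply: pack_inj; rewrite pack_copair -[pack (idH n)]/(pid n) pid_tens.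
by rewrite pcompI.
Qed.

Lemma liftH_mu : liftH muF = tcls Tmu.
Proof.
have -> : tcls Tmu = muH 1 by apply: pack_inj; rewrite pmuN1.
rewrite muH_copair; apply: (@homH_ext (1 + 1)) => i.
rewrite liftH_iota [muF _]muFE wordH_gen iotaH1.
case: (splitV i) => j; rewrite (ord1 j).
  by rewrite iotaH2l copairH_inl.
by rewrite iotaH2r copairH_inr.
Qed.

Lemma liftH_eta : liftH etaF = tcls Teta.
Proof.
by apply: pack_inj; rewrite -[RHS]petaN1.
Qed.

Lemma liftH_delta : liftH deltaF = tcls Tdelta.
Proof.
apply: homH_ext => i; rewrite liftH_iota [deltaF _]deltaFE gmulfM !wordH_gen.
rewrite iotaH1 compH1 iotaH2l iotaH2r.
(* The convolution of the two injections is their copairing, the identity, after [Tdelta]. *)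
by rewrite -[RHS]comp1H -(copairH_id 1 1).
Qed.

Lemma liftH_eps : liftH epsF = tcls Teps.
Proof.
apply: homH_ext => i; rewrite liftH_iota [epsF _]epsFE gmulf1.
by rewrite iotaH1 compH1 -[RHS]comp1H.
Qed.

Lemma liftH_anti : liftH antiF = tcls Tanti.
Proof.
apply: homH_ext => i; rewrite liftH_iota [antiF _]antiFE gmulfV wordH_gen.
by rewrite !iotaH1 compH1 -[RHS]comp1H.
Qed.

Program Definition liftH_functor : ssmfunctor ssmF ssmH :=
  @SSMFunctor ssmF ssmH (fun n => n) liftH _ _ _ _ _ _.
Next Obligation. exact: liftH_id. Qed.
Next Obligation. move=> m n p g f; exact: (@liftH_comp m n p g f). Qed.
Next Obligation. by []. Qed.
Next Obligation. by []. Qed.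
Next Obligation. by move=> m n m' n' f g; congr (arr _); apply: liftH_tens. Qed.
Next Obligation. by move=> m n; congr (arr _); apply: liftH_sym. Qed.

Lemma liftH_hopf : maps_hopf liftH_functor comm_hopfF comm_hopfH.
Proof.
split=> //; split; congr (arr _).
- exact: liftH_mu.
- exact: liftH_eta.
- exact: liftH_delta.
- exact: liftH_eps.
- exact: liftH_anti.
Qed.

(** * Evaluation of H in F *)

(* [interp] at the Hopf monoid of F, but strictly the identity on objects. *)
Fixpoint interpF m n (t : term m n) : @hom ssmF m n :=
  match t with
  | Tid n => @idm ssmF n
  | Tcomp _ _ _ g f => @comp ssmF _ _ _ (interpF g) (interpF f)
  | Ttens _ _ _ _ f g => @tensm ssmF _ _ _ _ (interpF f) (interpF g)
  | Tsymm m n => @symm ssmF m n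
  | Tmu => muF
  | Teta => etaF
  | Tdelta => deltaF
  | Teps => epsF
  | Tanti => antiF
  end.

Lemma interpF_eqid m n (e : m = n) : interpF (Teqid e) = @eqid ssmF m n e.
Proof. by destruct e. Qed.

Lemma interpF_eq m n m' n' (s : term m n) (t : term m' n') :
  s ≈ t -> interpF s ≡ interpF t.
Proof.
elim=> {m n m' n' s t} //.
- by move=> m n m' n' m'' n'' s t u _ -> _ ->.
- by move=> *; apply: heq_comp.
- by move=> *; apply: heq_tens.
- by move=> m n p q h g f; congr (arr _); apply: (@compA ssmF).
- by move=> m n f; congr (arr _); apply: (@comp1m ssmF).
- by move=> m n f; congr (arr _); apply: (@compm1 ssmF).
- by move=> m n; congr (arr _); apply: (@tens_id ssmF).
- by move=> m n p m' n' p' g f g' f'; congr (arr _); apply: (@tens_comp ssmF).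
- by move=> *; apply: (@tensmA ssmF).
- by move=> *; apply: (@tens1m ssmF).
- by move=> *; apply: (@tensm1 ssmF).
- by move=> *; congr (arr _); apply: (@symm_nat ssmF).
- by move=> *; congr (arr _); apply: (@symmK ssmF).
- by move=> *; apply: (@symm1 ssmF).
- by move=> m n p; rewrite /= interpF_eqid; apply: (@symm_tens ssmF).
- exact: (hmuA hopfF).
- exact: (hmu1m hopfF).
- exact: (hmum1 hopfF).
- exact: (hdeltaA hopfF).
- exact: (hdelta1m hopfF).
- exact: (hdeltam1 hopfF).
- by congr (arr _); apply: (heps_eta hopfF).
- exact: (heps_mu hopfF).
- exact: (hdelta_eta hopfF).
- have := hdelta_mu hopfF.
  (* The coercions in [hdelta_mu] and [E_delta_mu] differ only in the proof of the object
     equality. *)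
  rewrite (Prop_irrelevance (@tens_mid ssmF 1 1 1 1) (addn_mid 1 1 1 1)).
  rewrite -!(interpF_eqid (addn_mid 1 1 1 1)) -!interpF_eqid => e.
  by congr (arr _); apply: e.
- by congr (arr _); apply: (hanti_r hopfF).
- by congr (arr _); apply: (hanti_l hopfF).
- by congr (arr _); apply: (hmuC comm_hopfF).
Qed.

Definition evalF m n (f : homH m n) : group_hom (freeg m) (freeg n) :=
  interpF (trepr f).

Lemma evalFE m n (t : term m n) : evalF (tcls t) = interpF t.
Proof. exact: (@heq_eq ssmF _ _ _ _ (interpF_eq (trepr_cls t))). Qed.

Lemma evalF_comp m n p (g : homH n p) (f : homH m n) w :
  evalF (compH g f) w = evalF g (evalF f w).
Proof. by rewrite -[g]treprK -[f]treprK compHE !evalFE. Qed.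

Lemma evalF_tens m n m' n' (f : homH m n) (g : homH m' n') :
  evalF (tensH f g) = tensF (evalF f) (evalF g).
Proof. by rewrite -[g]treprK -[f]treprK tensHE !evalFE. Qed.

Lemma evalF_id n w : evalF (idH n) w = w.
Proof. by rewrite evalFE. Qed.

Lemma evalF_sym m n : evalF (symH m n) = symmF m n.
Proof. exact: evalFE. Qed.

Program Definition evalF_functor : ssmfunctor ssmH ssmF :=
  @SSMFunctor ssmH ssmF (fun n => n) evalF _ _ _ _ _ _.
Next Obligation. by move=> n; apply: evalFE. Qed.
Next Obligation.
by move=> m n p g f; apply: group_hom_inj => w; apply: evalF_comp.
Qed.
Next Obligation. by []. Qed.
Next Obligation. by []. Qed.
Next Obligation. by move=> m n m' n' f g; congr (arr _); apply: evalF_tens. Qed.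
Next Obligation. by move=> m n; congr (arr _); apply: evalF_sym. Qed.

Lemma evalF_hopf : maps_hopf evalF_functor comm_hopfH comm_hopfF.
Proof. by split=> //; split; congr (arr _); apply: evalFE. Qed.

Lemma evalF_inr m n i : evalF (inrH m n) (x_ i) = x_ (rshift m i).
Proof.
rewrite [evalF _](evalF_tens (etaH m) (idH n)).
(* The source [n] is seen as [0 + n], so that [i] lies in the right summand. *)
rewrite -[i in LHS](_ : rshift 0 i = i); last exact: val_inj.
by rewrite tensFr evalF_id shiftFE.
Qed.

Lemma evalF_inl m n i : evalF (inlH m n) (x_ i) = x_ (lshift n i).
Proof. by rewrite evalF_comp evalF_inr evalF_sym symmFr. Qed.

Lemma evalF_iota n i : evalF (iotaH i : homH 1 n) (x_ ord0) = x_ i.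
Proof.
elim: n i => [|n IHn] i; first by case: i.
case: (splitV (i : 'I_(1 + n))) => j.
  by rewrite iotaHl evalF_inl (ord1 j).
rewrite iotaHr evalF_comp IHn; exact: (evalF_inr 1 j).
Qed.

Lemma evalF_copair m n p (f : homH m p) (g : homH n p) :
  evalF (copairH f g) = homF (fun i => match split i with
    | inl j => evalF f (x_ j) | inr j => evalF g (x_ j) end).
Proof.
apply: homF_ext => i; rewrite homFE; case: (splitV i) => j.
  by rewrite (unsplitK (inl j)) -evalF_inl -evalF_comp copairH_inl.
by rewrite (unsplitK (inr j)) -evalF_inr -evalF_comp copairH_inr.
Qed.

Section EvalFGen.
Variable n : nat.

Definition evalF_gen (c : cogroup n) : freeg n := evalF c (x_ ord0).

(** Convolution becomes multiplication in the free group because [deltaF] sends the generator to the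
    product of the two generators. *)
Fact evalF_gen_monoid : monoid_morphism evalF_gen.
Proof.
split=> [|f g]; rewrite /evalF_gen evalF_comp evalFE /=.
  by rewrite [epsF _]epsFE gmulf1.
rewrite [deltaF _]deltaFE gmulfM evalF_copair !homFE.
by rewrite (unsplitK (inl ord0)) (unsplitK (inr ord0)).
Qed.

HB.instance Definition _ :=
  isUMagmaMorphism.Build (cogroup n) (freeg n) evalF_gen evalF_gen_monoid.

End EvalFGen.

Lemma evalF_word n w : evalF (wordH n w) (x_ ord0) = w.
Proof.
apply: (congr1 (fun h : group_hom _ _ => h w) (_ :
  (@evalF_gen n \o wordH n : group_hom _ _) = idfun)).
by apply: homF_ext => i; rewrite /= wordH_gen /evalF_gen evalF_iota.
Qed.

Lemma liftHK m n (f : group_hom (freeg m) (freeg n)) : evalF (liftH f) = f.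
Proof.
apply: homF_ext => i.
by rewrite -evalF_iota -evalF_comp liftH_iota evalF_word evalF_iota.
Qed.

(** * The isomorphism of H and F *)

Lemma maps_hopf_comp (C D E : ssmcat) (G : ssmfunctor D E) (T : ssmfunctor C D)
    (A : hopf_monoid C) (B : hopf_monoid D) (H : hopf_monoid E) :
  maps_hopf T A B -> maps_hopf G B H -> maps_hopf (functor_comp G T) A H.
Proof.
move=> [T1 [Tmu Teta Tdelta Teps Tanti]] [G1 [Gmu Geta Gdelta Geps Ganti]].
split; first by rewrite /= T1.
by split=> /=; [rewrite (heq_fhom G Tmu) | rewrite (heq_fhom G Teta)
  | rewrite (heq_fhom G Tdelta) | rewrite (heq_fhom G Teps)
  | rewrite (heq_fhom G Tanti)].
Qed.

Theorem theorem8 (T : ssmfunctor ssmH ssmF)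
    (hT : maps_hopf T comm_hopfH comm_hopfF) :
  is_ssm_isomorphism T.
Proof.
have -> : T = evalF_functor.
  by rewrite (freeH_unique hT) (freeH_unique evalF_hopf).
exists liftH_functor; split.
  (* This composite and the identity of H both fix the generating Hopf monoid, so freeness of H
     identifies them. *)
  rewrite (freeH_unique (maps_hopf_comp evalF_hopf liftH_hopf)).
  by apply: esym; apply: freeH_unique; split.
(* On F the composite is compared with the identity morphism by morphism, through generators. *)
apply: functor_ext => // m n f.
by congr (arr _); apply: liftHK.
Qed.
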